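(* Let $\Delta_n$ ($n\ge 2$) be the distance between two randomly selected keys in a random binary trie on $n$ keys following the unbiased Bernoulli model. Then, as $n\to\infty$, $$\mathbf{E}[\Delta_n] = 2\lg n + \eta(\lg n) - \frac{\ln 2 - 2\gamma}{\ln 2} + O\left(\frac{1}{n^{0.4999}}\right),$$ where $\eta(u) = -2\,\eta_2(u)$ and $$\eta_2(u) = \frac{1}{\ln 2}\sum_{j\in\mathbb{Z},\, j\neq 0}\Gamma\left(\frac{2\pi i j}{\ln 2}\right)e^{-2\pi i j u}.$$
   Context: Notation: $\lg=\log_2$; $\gamma$ is Euler's constant; $\Gamma$ is the gamma function. Trie: given $n$ keys, each an infinite sequence of bits, the binary trie is built recursively. If $n=0$ the tree is empty. If $n=1$ it is a single leaf holding the key. If $n\ge 2$ it has an internal root node; the keys whose first bit is $0$ go to the left subtree and those whose first bit is $1$ go to the right subtree, and each subtree is built recursively from its keys, using the $(\ell+1)$st bit for branching at level $\ell$ (the root is at level $0$). Thus internal nodes may have one or two (nonempty) children, and each key ends up alone in a leaf. Unbiased Bernoulli model: the $n$ keys are independent, and the bits of each key are independent and take the values $0$ and $1$ with probability $1/2$ each. Distance: $\Delta_n$ is the number of tree edges on the path between the leaves of two distinct keys chosen uniformly at random among the $\binom n2$ pairs of keys, independently of the trie; both the trie and the pair are random. *)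

(* Defs.v *)
From mathcomp Require Import all_boot all_order all_algebra finmap.
From mathcomp Require Import all_classical all_reals all_analysis.
From mathcomp Require Export complex.

Set Implicit Arguments.
Unset Strict Implicit.
Unset Printing Implicit Defensive.

Import Order.TTheory GRing.Theory Num.Theory.
Import numFieldNormedType.Exports.

Inductive trie (K : Type) : Type :=
| Nil_trie
| Leaf_trie of K
| Node_trie of trie K & trie K.

Arguments Nil_trie {K}.

Section Trie.
Variable n : nat.

(* [is_trie key l A t]: [t] is the trie of the keys in [A], with branching
   starting at bit [l].  A trie is finite, so there is one exactly when the keys
   in [A] are pairwise distinct from bit [l] on. *)
Inductive is_trie (key : 'I_n -> nat -> bool) :
  nat -> {set 'I_n} -> trie 'I_n -> Prop :=
| TrieEmpty l : is_trie key l finset.set0 Nil_trie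
| TrieLeaf l i : is_trie key l [set i]%SET (Leaf_trie i)
| TrieNode l (A : {set 'I_n}) t0 t1 : (2 <= #|A|)%N ->
    is_trie key l.+1 [set i in A | ~~ key i l]%SET t0 ->
    is_trie key l.+1 [set i in A | key i l]%SET t1 ->
    is_trie key l A (Node_trie t0 t1).

(* Nodes are addressed by the bits leading to them from the root. *)
Fixpoint subtrie (t : trie 'I_n) (v : seq bool) : trie 'I_n :=
  match v, t with
  | [::], _ => t
  | b :: v', Node_trie t0 t1 => subtrie (if b then t1 else t0) v'
  | _, _ => Nil_trie
  end.

Definition is_vertex t v : bool := if subtrie t v is Nil_trie then false else true.

Definition tree_edge t : rel (seq bool) := fun v w =>
  [&& is_vertex t v, is_vertex t w &
      [exists b, w == rcons v b] || [exists b, v == rcons w b]].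

(* A path listed as its [d.+1] successive distinct vertices [v :: p] has
   [d = size p] edges. *)
Definition is_leaf_distance t (i j : 'I_n) (d : nat) : Prop :=
  exists v p, [/\ subtrie t v = Leaf_trie i, subtrie t (last v p) = Leaf_trie j,
    path (tree_edge t) v p, uniq (v :: p) & size p = d].

(* The default value [0] serves only when two keys are equal, which has
   probability [0] in the model below. *)
Definition trie_distance (key : 'I_n -> nat -> bool) (ij : 'I_n * 'I_n) : nat :=
  xget 0%N (fun d : nat => exists2 t,
    is_trie key 0 finset.setT t & is_leaf_distance t ij.1 ij.2 d).

End Trie.

Local Open Scope classical_set_scope.
Local Open Scope ring_scope.

Section Model.
Context {d : measure_display} {T : measurableType d} {R : realType}.
Variable P : probability T R.

(* The classes [F i] are meant to be sigma-algebras of events. *)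
Definition mutually_independent (I : choiceType) (F : I -> set_system T) : Prop :=
  forall (J : {fset I}) (A : I -> set T), (forall i, i \in J -> F i (A i)) ->
    P (\bigcap_(i in [set` J]) A i) = (\prod_(i <- J) P (A i))%E.

Variable n : nat.

Definition bit_event (key : T -> 'I_n -> nat -> bool) i l : set T :=
  [set w | key w i l].

Definition unbiased_bernoulli (key : T -> 'I_n -> nat -> bool) : Prop :=
  [/\ forall i l, measurable (bit_event key i l),
      forall i l, P (bit_event key i l) = (2^-1)%:E,
      forall i, mutually_independent (fun l => <<s [set bit_event key i l] >>) &
      mutually_independent (fun i => <<s range (bit_event key i) >>)].

(* An unordered pair of keys is represented by the couple of its indices in
   increasing order. *)
Definition uniform_pair (pair : T -> 'I_n * 'I_n) : Prop :=
  [/\ forall w, ((pair w).1 < (pair w).2)%N,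
      forall ij, measurable (pair @^-1` [set ij]) &
      forall i j : 'I_n, (i < j)%N ->
        P (pair @^-1` [set (i, j)]) = ('C(n, 2)%:R^-1)%:E].

Definition pair_independent (key : T -> 'I_n -> nat -> bool)
    (pair : T -> 'I_n * 'I_n) : Prop :=
  forall A B : set T,
    <<s [set bit_event key x.1 x.2 | x in [set: 'I_n * nat]] >> A ->
    <<s [set pair @^-1` [set ij] | ij in [set: 'I_n * 'I_n]] >> B ->
    P (A `&` B) = (P A * P B)%E.

Definition Delta (key : T -> 'I_n -> nat -> bool) (pair : T -> 'I_n * 'I_n)
    (w : T) : R :=
  (trie_distance (key w) (pair w))%:R.

End Model.

Section Functions.
Context {R : realType}.
Local Open Scope complex_scope.

Definition lg (x : R) : R := ln x / ln 2.

Definition euler_gamma : R :=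
  limn (fun n : nat => \sum_(1 <= k < n.+1) k%:R^-1 - ln n%:R).

Definition cexp (z : R[i]) : R[i] :=
  (expR (complex.Re z))%:C * (cos (complex.Im z) +i* sin (complex.Im z)).

(* Euler's integral, which converges for [0 < Re z]. *)
Definition Gamma_integral (z : R[i]) : R[i] :=
  let f (t : R) : R[i] := cexp ((z - 1) * (ln t)%:C) * (expR (- t))%:C in
  Rintegral lebesgue_measure `]0, +oo[ (fun t => complex.Re (f t)) +i*
  Rintegral lebesgue_measure `]0, +oo[ (fun t => complex.Im (f t)).

(* The continuation to [Re z <= 0] by [Gamma z = Gamma (z + 1) / z], applied
   until the argument enters the half-plane of convergence.  At the poles the
   value is [0], division by zero being total. *)
Definition Gamma (z : R[i]) : R[i] :=
  let m := if 0 < complex.Re z then 0%N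
           else (Num.truncn (- complex.Re z)).+1 in
  Gamma_integral (z + m%:R) / \prod_(0 <= k < m) (z + k%:R).

(* The sum over [j <> 0] of a family indexed by the integers; both one-sided
   series are required to converge.  Limits are taken in [R[i]^o], whose canonical
   topology is that of the complex modulus. *)
Definition punctured_series_cvg (a : int -> R[i]) : Prop :=
  cvgn (fun N : nat => \sum_(1 <= j < N.+1) a j%:Z : R[i]^o) /\
  cvgn (fun N : nat => \sum_(1 <= j < N.+1) a (- j%:Z) : R[i]^o).

Definition punctured_series (a : int -> R[i]) : R[i] :=
  limn (fun N : nat => \sum_(1 <= j < N.+1) a j%:Z : R[i]^o) +
  limn (fun N : nat => \sum_(1 <= j < N.+1) a (- j%:Z) : R[i]^o).

Definition eta2_term (u : R) (j : int) : R[i] :=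
  Gamma (2 * pi%:C * 'i * j%:~R / (ln 2)%:C) *
  cexp (- (2 * pi%:C * 'i * j%:~R * u%:C)).

Definition eta2 (u : R) : R[i] :=
  ((ln 2)%:C)^-1 * punctured_series (eta2_term u).

Definition eta (u : R) : R[i] := - 2 * eta2 u.

End Functions.

(* Main.v *)
(** The path between the leaves of keys [i] and [j] has
    [depth i + depth j - 2 * lcp] edges; [i] has depth greater than [m] exactly
    when another key shares its first [m] bits, an event of probability
    [1 - (1 - 2^-m)^(n-1)].  Hence [E Delta_n = 2 a - 2], where
    [a = \sum_(m >= 0) (1 - (1 - 2^-m)^N)] and [N = n - 1].

    The sum [a] is compared with [\int_0^oo (1 - (1 - 2^-v)^N) dv], which is
    [H_N / ln 2]: by Euler-Maclaurin the difference is [1/2] plus the integral of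
    the derivative against the sawtooth, whose truncated Fourier series turns this
    integral into a combination of [\int_0^1 N (1 - y)^(N-1) sin (w ln y) dy] with
    [w = 2 pi j / ln 2].  Each of these is within [O(1/n)] of
    [\int_0^oo exp (- y) sin (w (ln y - ln n)) dy], that is, of the imaginary part
    of [Gamma (1 + i w) n^(- i w)].  All the integral estimates are obtained by
    comparing derivatives of primitives ([ler_dist_deriveR]). *)
Require Import Defs.
From mathcomp Require Import all_boot all_order all_algebra finmap.
From mathcomp Require Import all_classical all_reals all_analysis.
From mathcomp Require Import measurable_realfun zify ring lra.

Set Implicit Arguments.
Unset Strict Implicit.
Unset Printing Implicit Defensive.
Import Order.TTheory GRing.Theory Num.Theory.
Import numFieldNormedType.Exports.

Local Open Scope classical_set_scope.
Local Open Scope ring_scope.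

(** * Distances in tries *)

Section SimplePaths.
Local Open Scope nat_scope.
Variable n : nat.
Implicit Types (t : trie 'I_n) (v w s : seq bool).

(** The obstacle is that the Fourier series of the sawtooth does not converge uniformly near the
    integers. Only finite partial sums are integrated: away from the integers the remainder after
    [J] terms is [O(1 / (J t))], and on a small neighbourhood of them a crude bound suffices. [J]
    can be a power of [n], because replacing a Beta integral by a Gamma integral costs [O(1/n)]
    uniformly in the frequency, and the weights [1 / (pi j)] add up to a logarithm only. The total
    error [O(ln n / n)] is relaxed to [5000 / sqrt n], which is below the required [n^-0.4999] rate.
    The constant term is [2 (1/2 + gamma / ln 2) - 2]. On the probabilistic side, each depth and
    each common prefix length is a count of levels, so that the distance becomes a series of
    indicators. A trie exists only for pairwise distinct keys; this holds almost surely, and the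
    default distance 0 elsewhere does not affect the expectation. *)

Fixpoint lcp s1 s2 : nat :=
  match s1, s2 with
  | a :: s1', b :: s2' => if a == b then (lcp s1' s2').+1 else 0
  | _, _ => 0
  end.

Lemma lcp_prefix v w : prefix v w -> lcp v w = size v.
Proof.
by elim: v w => [|a v IHv] [|b w] //=; case: eqP => //= _ /IHv ->.
Qed.

Lemma lcp_rcons v w b : ~~ prefix (rcons v b) w -> lcp (rcons v b) w = lcp v w.
Proof.
elim: v w => [|a v IHv] [|c w] //=; case: eqP => //= _; first by rewrite prefix0s.
by move=> /IHv ->.
Qed.

Lemma prefix_rcons2 v w b : prefix v (rcons w b) = prefix v w || (v == rcons w b).
Proof.
elim: v w => [|a v IHv] [|c w]; rewrite ?prefix0s//= ?eqseq_cons ?IHv.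
by case: eqP.
Qed.

Definition bit_edge v w := [exists b, w == rcons v b] || [exists b, v == rcons w b].

Lemma tree_edgeW t v w : tree_edge t v w -> bit_edge v w.
Proof. by case/and3P. Qed.

(* A path that avoids [v] can neither enter nor leave the subtree of [v], nor
   that of a child of [v]. *)
Lemma prefix_last_path s v w p : v = s \/ (exists b, v = rcons s b) ->
  path bit_edge w p -> s \notin w :: p -> prefix v (last w p) = prefix v w.
Proof.
move=> vs; elim: p w => [|x p IHp] w //= /andP[wx px]; rewrite inE negb_or => /andP[sw sp].
rewrite IHp//; move: sp; rewrite inE negb_or => /andP[sx _].
case/orP: wx => /fintype.existsP[b /eqP E]; rewrite E prefix_rcons2.
  case: eqP => [vE|]; rewrite ?orbF//.
  case: vs => [vs|[c vs]].
    by move: sx; rewrite -vs vE E eqxx.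
  by move: sw; rewrite vs in vE; have [-> _] := rcons_inj vE; rewrite eqxx.
case: eqP => [vE|]; rewrite ?orbF//.
case: vs => [vs|[c vs]].
  by move: sw; rewrite -vs vE E eqxx.
by move: sx; rewrite vs in vE; have [-> _] := rcons_inj vE; rewrite eqxx.
Qed.

(** Induction on the path. If the first edge goes down to a child [x], the rest avoids [v], hence
    stays below [x], and both common prefixes are whole addresses. If it goes up, the rest never
    comes back below [v], so replacing [v] by its parent leaves the common prefix unchanged. *)
Lemma size_simple_path v p : path bit_edge v p -> uniq (v :: p) ->
  size p + 2 * lcp v (last v p) = size v + size (last v p).
Proof.
elim: p v => [|x p IHp] v.
  by move=> _ _ /=; rewrite lcp_prefix ?prefix_refl// mul2n -addnn.
rewrite [path _ _ _]/= [uniq _]/= [last _ _]/= => /andP[vx px] /andP[vp /andP[xp up]].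
have := IHp x px; rewrite /= xp up => /(_ isT) IH.
case/orP: vx => /fintype.existsP[b /eqP E].
  have px' : prefix x (last x p).
    by rewrite (@prefix_last_path v x) ?prefix_refl//; right; exists b.
  have vx' : prefix v (last x p).
    by apply: prefix_trans px'; rewrite E prefix_rcons.
  move: IH; rewrite !lcp_prefix// E size_rcons; lia.
have nv : ~~ prefix v (last x p).
  rewrite (@prefix_last_path v v)//; last by left.
  by rewrite E; apply/negP => /size_prefix; rewrite size_rcons ltnn.
have -> : lcp v (last x p) = lcp x (last x p) by rewrite E lcp_rcons -?E.
by rewrite E size_rcons; lia.
Qed.

Lemma subtrie_rcons t v b : subtrie t (rcons v b) =
  if subtrie t v is Node_trie t0 t1 then if b then t1 else t0 else Nil_trie.
Proof.
by elim: v t => [|c v IHv] [|i|t0 t1] //=; case: (if b then t1 else t0).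
Qed.

Lemma tree_edge_sym t : symmetric (tree_edge t).
Proof. by move=> v w; rewrite /tree_edge orbC andbCA. Qed.

Lemma tree_root_path t v : is_vertex t v ->
  exists2 p, path (tree_edge t) [::] p & last [::] p = v.
Proof.
elim/last_ind: v => [|v b IHv] tv; first by exists [::].
have tv' : is_vertex t v.
  by move: tv; rewrite /is_vertex subtrie_rcons; case: subtrie.
have [p pp pv] := IHv tv'; exists (rcons p (rcons v b)); rewrite ?last_rcons//.
rewrite rcons_path pp pv /tree_edge tv tv'/=; apply/orP; left.
by apply/fintype.existsP; exists b.
Qed.

Lemma tree_simple_path t v w : is_vertex t v -> is_vertex t w ->
  exists p, [/\ path (tree_edge t) v p, uniq (v :: p) & last v p = w].
Proof.
move=> /tree_root_path[p pp pv] /tree_root_path[q qq qw].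
have vp : path (tree_edge t) v (rev (belast [::] p)).
  rewrite -pv rev_path; rewrite (eq_path (e' := tree_edge t))//.
  by move=> x y; rewrite tree_edge_sym.
have lv : last v (rev (belast [::] p)) = [::].
  rewrite -pv; case: (p) => [//|x p'] /=.
  by rewrite rev_cons last_rcons.
have vq : path (tree_edge t) v (rev (belast [::] p) ++ q) by rewrite cat_path vp lv.
have lw : last v (rev (belast [::] p) ++ q) = w by rewrite last_cat lv.
by case: (shortenP vq) lw => p' pp' up' _ lw; exists p'; split.
Qed.

End SimplePaths.

(** * Depths and common prefixes in a trie *)

Section TrieDistance.
Local Open Scope nat_scope.
Variables (n : nat) (key : 'I_n -> nat -> bool).

Fixpoint addr l m i : seq bool := if m is m'.+1 then key i l :: addr l.+1 m' i else [::].

Lemma addrE l m i : addr l m i = mkseq (fun r => key i (l + r)) m.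
Proof.
elim: m l => // m IHm l; rewrite /= IHm /mkseq/= addn0; congr (_ :: _).
by rewrite (iotaDl 1 0) -map_comp; apply: eq_map => r /=; rewrite add1n addnS.
Qed.

Lemma take_addr l m m' i : m <= m' -> take m (addr l m' i) = addr l m i.
Proof.
elim: m l m' => [|m IHm] l [|m'] //=.
by rewrite ltnS => mm'; rewrite IHm.
Qed.

Lemma addr_eqW l m m' i k : m <= m' -> addr l m' i = addr l m' k -> addr l m i = addr l m k.
Proof. by move=> mm' E; rewrite -(take_addr _ _ mm') E take_addr. Qed.

Definition isolated l (A : {set 'I_n}) i m :=
  forall k, k \in A -> addr l m k = addr l m i -> k = i.

(** Splitting continues as long as two keys remain, so a leaf sits at the shortest prefix that
    isolates its key; its depth depends on the keys alone. *)
Lemma is_trie_leaf l A t v i : is_trie key l A t -> subtrie t v = Leaf_trie i ->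
  [/\ i \in A, v = addr l (size v) i, isolated l A i (size v) &
      forall m, m < size v -> ~ isolated l A i m].
Proof.
move=> tA; elim: tA v => {l A t} [l|l k|l A t0 t1 A2 _ IH0 _ IH1] v.
- by case: v.
- case: v => [|//] [<-]; split => //; first by rewrite set11.
  by move=> k'; rewrite inE => /eqP.
case: v => [//|b v] /= tv.
have [iA vE iso niso] : [/\ i \in [set x in A | key x l == b]%SET,
    v = addr l.+1 (size v) i, isolated l.+1 [set x in A | key x l == b]%SET i (size v) &
    forall m, m < size v -> ~ isolated l.+1 [set x in A | key x l == b]%SET i m].
  have -> : [set x in A | key x l == b]%SET =
      if b then [set x in A | key x l]%SET else [set x in A | ~~ key x l]%SET.
    by case: (b); apply/finset.setP => x; rewrite !inE; case: key.
  by move: tv; case: b => tv; [exact: IH1|exact: IH0].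
move: iA; rewrite inE => /andP[iA /eqP ib]; split => //.
- by rewrite ib -vE.
- move=> k kA [kb kv]; apply: iso => //; rewrite inE kA kb ib eqxx//.
- move=> [_|m] /=.
    move=> iso0; move: A2; rewrite (cardsD1 i) iA add1n ltnS card_gt0 => /set0Pn[k].
    by rewrite in_setD1 => /andP[/eqP ki kA]; apply: ki; exact: iso0.
  rewrite ltnS => mv isom; apply: (niso m mv) => k; rewrite inE => /andP[kA /eqP kb] E.
  by apply: isom => //=; rewrite kb ib E.
Qed.

Lemma is_trie_has_leaf l A t i : is_trie key l A t -> i \in A ->
  exists v, subtrie t v = Leaf_trie i.
Proof.
elim=> {l A t} [l|l k|l A t0 t1 A2 _ IH0 _ IH1].
- by rewrite inE.
- by rewrite inE => /eqP ->; exists [::].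
move=> iA; case kl : (key i l).
  by have [|v] := IH1; rewrite ?inE ?iA// => tv; exists (true :: v).
by have [|v] := IH0; rewrite ?inE ?iA ?kl// => tv; exists (false :: v).
Qed.

(** Induction on a number [m] of bits that suffices to tell the keys apart: each split consumes
    one. *)
Lemma is_trie_exists l (A : {set 'I_n}) m : (forall i k, i \in A -> k \in A ->
  addr l m i = addr l m k -> i = k) -> exists t, is_trie key l A t.
Proof.
elim: m l A => [|m IHm] l A dist.
  have [->|[i iA]] := set_0Vmem A; first by exists Nil_trie; constructor.
  exists (Leaf_trie i); suff -> : A = [set i]%SET by constructor.
  by apply/finset.setP => k; rewrite inE; apply/idP/eqP => [kA|->//]; exact: dist.
have [A2|] := leqP 2 #|A|.
  have [|t0 T0] := IHm l.+1 [set i in A | ~~ key i l]%SET.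
    move=> i k; rewrite !inE => /andP[iA /negPf ib] /andP[kA /negPf kb] E.
    by apply: dist => //=; rewrite ib kb E.
  have [|t1 T1] := IHm l.+1 [set i in A | key i l]%SET.
    move=> i k; rewrite !inE => /andP[iA ib] /andP[kA kb] E.
    by apply: dist => //=; rewrite ib kb E.
  by exists (Node_trie t0 t1); constructor.
case: (posnP #|A|) => [/eqP|A0 A2]; first by rewrite cards_eq0 => /eqP ->; exists Nil_trie; constructor.
have /cards1P[i ->] : #|A| == 1 by rewrite eqn_leq A0 -ltnS A2.
by exists (Leaf_trie i); constructor.
Qed.

Lemma is_trie_distinct l A t : is_trie key l A t -> exists m, forall i k, i \in A -> k \in A ->
  addr l m i = addr l m k -> i = k.
Proof.
elim=> {l A t} [l|l i|l A t0 t1 A2 _ [m0 IH0] _ [m1 IH1]].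
- by exists 0 => i k; rewrite inE.
- by exists 0 => x y; rewrite !inE => /eqP -> /eqP ->.
exists (maxn m0 m1).+1 => i k iA kA /= [kE aE]; case kl: (key k l).
  by apply: IH1; rewrite ?inE ?iA ?kA ?kE ?kl//; apply: addr_eqW aE; rewrite leq_maxr.
by apply: IH0; rewrite ?inE ?iA ?kA ?kE ?kl//; apply: addr_eqW aE; rewrite leq_maxl.
Qed.

Definition agree m i k := addr 0 m i == addr 0 m k.
Definition crowded m i := [exists k, (k != i) && agree m k i].
Definition keys_separated m := [forall i, forall k, agree m i k ==> (i == k)].

Lemma keys_separatedP m : reflect (forall i k, agree m i k -> i = k) (keys_separated m).
Proof.
apply: (iffP fintype.forallP) => [h i k ik|h i]; last by apply/fintype.forallP => k; apply/implyP => /h ->.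
by have /fintype.forallP/(_ k)/implyP/(_ ik)/eqP := h i.
Qed.

Lemma agreeW m m' i k : m <= m' -> agree m' i k -> agree m i k.
Proof. by move=> mm' /eqP E; apply/eqP; exact: addr_eqW E. Qed.

Lemma isolatedP m i : isolated 0 [set: 'I_n]%SET i m <-> ~~ crowded m i.
Proof.
split=> [iso|nc k _ E].
  by apply/negP => /fintype.existsP[k /andP[ki /eqP E]]; move: ki; rewrite (iso k)// ?eqxx ?inE.
apply/eqP; apply/negP => /negP ki; move/negP: nc; apply; apply/fintype.existsP; exists k.
by rewrite ki; apply/eqP.
Qed.

Lemma crowded_leaf t v i m : is_trie key 0 [set: 'I_n]%SET t -> subtrie t v = Leaf_trie i ->
  crowded m i = (m < size v).
Proof.
move=> T tv; have [_ vE iso niso] := is_trie_leaf T tv.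
have [mv|vm] := ltnP m (size v).
  by apply: contraT => /isolatedP /(niso _ mv).
rewrite /crowded; apply/fintype.existsP => -[k /andP[/eqP ki E]]; apply: ki; apply: iso; rewrite ?inE//.
by move/eqP: E; exact: addr_eqW.
Qed.

Lemma lcp_addr l a b i k m : m <= a -> m <= b ->
  (m <= lcp (addr l a i) (addr l b k)) = (addr l m i == addr l m k).
Proof.
elim: m l a b => [|m IHm] l [|a] [|b] //= ma mb.
rewrite eqseq_cons; case: eqP => //= _; exact: IHm.
Qed.

Lemma lcp_le_size s1 s2 : lcp s1 s2 <= minn (size s1) (size s2).
Proof.
elim: s1 s2 => [|a s1 IHs] [|b s2] //=; rewrite ?min0n// minnSS.
by case: eqP => // _; rewrite ltnS.
Qed.

Lemma agree_leaf t v w i k m : is_trie key 0 [set: 'I_n]%SET t ->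
  subtrie t v = Leaf_trie i -> subtrie t w = Leaf_trie k -> i != k ->
  agree m i k = (m <= lcp v w).
Proof.
move=> T tv tw ik; have [_ vE _ _] := is_trie_leaf T tv; have [_ wE _ _] := is_trie_leaf T tw.
have [mv|vm] := leqP m (minn (size v) (size w)).
  by rewrite vE wE lcp_addr//; move: mv; rewrite leq_min => /andP[].
rewrite [RHS]leqNgt (leq_ltn_trans (lcp_le_size v w) vm)/=.
(* Beyond the shorter address, agreement would crowd both keys at level [m], and both leaves would
   lie deeper than [m]. *)
apply/negP => E; suff : m < minn (size v) (size w) by rewrite ltnNge ltnW.
rewrite leq_min -(crowded_leaf _ T tv) -(crowded_leaf _ T tw).
apply/andP; split; apply/fintype.existsP; last by exists i; rewrite ik.
by exists k; rewrite eq_sym ik /agree eq_sym.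
Qed.

Lemma sum_ltn (D M : nat) : D <= M -> \sum_(0 <= m < M) (m < D) = D.
Proof.
move=> DM; rewrite (big_cat_nat (n := D))//= -[RHS]addn0; congr (_ + _).
  rewrite big_nat (eq_bigr (fun=> 1)); first by rewrite -big_nat sum_nat_const_nat subn0 muln1.
  by move=> i /andP[_ ->].
by rewrite big_nat big1// => i /andP[Di _]; rewrite ltnNge Di.
Qed.

(** A depth counts the levels [m < depth] where its key is crowded. Agreement holds for [m <= lcp],
    so its count starts at level 1 to give [lcp]. *)
Lemma leaf_distance_sum t i k d M : is_trie key 0 [set: 'I_n]%SET t -> i != k ->
  is_leaf_distance t i k d -> keys_separated M ->
  d + 2 * \sum_(1 <= m < M) agree m i k = \sum_(0 <= m < M) (crowded m i + crowded m k).
Proof.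
move=> T ik [v [p [tv tw vp up dE]]] sM; set w := last v p in tw.
have bp : path bit_edge v p by apply: sub_path vp => x y; exact: tree_edgeW.
have := size_simple_path bp up; rewrite dE -/w => E.
have small x j : subtrie t x = Leaf_trie j -> size x <= M.
  move=> tx; rewrite leqNgt -(crowded_leaf _ T tx); apply/fintype.existsP => -[k' /andP[/eqP k'j]].
  by move/keys_separatedP: sM => /[apply].
have lM : lcp v w < M.
  rewrite ltnNge -(agree_leaf _ T tv tw ik); apply/negP => a.
  by move/eqP: ik; apply; move/keys_separatedP: sM; apply.
rewrite big_split/=.
under [X in _ = X + _]eq_bigr do rewrite (crowded_leaf _ T tv).
under [X in _ = _ + X]eq_bigr do rewrite (crowded_leaf _ T tw).
rewrite (sum_ltn (small _ _ tv)) (sum_ltn (small _ _ tw)).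
under eq_bigr do rewrite (agree_leaf _ T tv tw ik).
rewrite -(ltn_predK lM) big_add1/=.
by rewrite (@sum_ltn (lcp v w)) ?E// -ltnS (ltn_predK lM).
Qed.

Lemma trie_distance_sum i k M : i != k -> keys_separated M ->
  trie_distance key (i, k) + 2 * \sum_(1 <= m < M) agree m i k =
  \sum_(0 <= m < M) (crowded m i + crowded m k).
Proof.
move=> ik sM.
have [|t T] := @is_trie_exists 0 [set: 'I_n]%SET M.
  by move=> x y _ _ E; move/keys_separatedP: sM; apply; exact/eqP.
have [v tv] := is_trie_has_leaf T (finset.in_setT i); have [w tw] := is_trie_has_leaf T (finset.in_setT k).
have [||p [pp up pw]] := @tree_simple_path _ t v w; rewrite /is_vertex ?tv ?tw//.
have ex : [set d | exists2 t, is_trie key 0 finset.setT t & is_leaf_distance t i k d] (size p).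
  by exists t => //; exists v, p; split => //; rewrite pw.
(* Whatever value [xget] picks obeys the identity, and the witness [ex] rules out the default. *)
rewrite /trie_distance/=; case: xgetP => [d _ [t' T' dd]|/(_ _ ex)//].
exact: (leaf_distance_sum T').
Qed.

Lemma trie_distance_not_separated ij : (forall M, ~~ keys_separated M) -> trie_distance key ij = 0.
Proof.
move=> nsep; rewrite /trie_distance; case: xgetP => // d _ [t T _].
have [m h] := is_trie_distinct T; have /negP := nsep m; case; apply/keys_separatedP => i k /eqP.
exact: h.
Qed.

End TrieDistance.

(** * Probabilities of coincidences between keys *)

Section FiniteEvents.
Context {d : measure_display} {T : measurableType d}.

(** A property of finitely many booleans is a finite union, over the truth tables that satisfy it,
    of finite intersections. *)
Lemma measurable_ffun (X : finType) (b : T -> X -> bool) (S : pred {ffun X -> bool}) :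
  (forall x, measurable [set w | b w x]) -> measurable [set w | S [ffun x => b w x]].
Proof.
move=> mb.
have -> : [set w | S [ffun x => b w x]] = \bigcup_(g in [set g | S g])
    \bigcap_(x in [set: X]) (if g x then [set w | b w x] else ~` [set w | b w x]).
  apply/seteqP; split=> [w Sw|w [g Sg gw]] /=.
    exists [ffun x => b w x] => //= x _; rewrite ffunE; case: ifPn => //=.
    by move/negP.
  suff -> : [ffun x => b w x] = g by [].
  by apply/ffunP => x; rewrite ffunE; have := gw x I; case: (g x) => //= /negP /negPf.
apply: fin_bigcup_measurable; first exact: finite_finset.
move=> g _; apply: fin_bigcap_measurable; first exact: finite_finset.
by move=> x _; case: (g x) => //; exact: measurableC.
Qed.

End FiniteEvents.

(** The previous lemma read in the measurable space generated by [G]: independence asks for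
    membership in generated sigma-algebras. *)
Lemma sigma_ffun (T : pointedType) (G : set_system T) (X : finType) (b : T -> X -> bool)
    (S : pred {ffun X -> bool}) :
  (forall x, <<s G >> [set w | b w x]) -> <<s G >> [set w | S [ffun x => b w x]].
Proof. exact: (@measurable_ffun _ (g_sigma_algebraType G) X b S). Qed.

Section TotalProbability.
Context {d : measure_display} {T : measurableType d} {R : realType}.
Variable P : probability T R.

Lemma prod_EFin (I : Type) (r : seq I) (Q : pred I) (f : I -> R) :
  (\prod_(i <- r | Q i) (f i)%:E)%E = (\prod_(i <- r | Q i) f i)%:E.
Proof. by rewrite (big_morph EFin (@EFinM R) erefl). Qed.

Lemma total_probability (X : finType) (f : T -> X) (A : set T) : measurable A ->
  (forall x, measurable (f @^-1` [set x])) ->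
  P A = (\sum_(x : X) P (A `&` f @^-1` [set x]))%E.
Proof.
move=> mA mf.
have {1}-> : A = \bigcup_(x in [set: X]) (A `&` f @^-1` [set x]).
  by apply/seteqP; split=> [w Aw|w [x _ []]//]; exists (f w).
rewrite measure_fin_bigcup.
- rewrite (_ : [set: X] = [set` enum X]); last by apply/seteqP; split=> x //=; rewrite mem_enum.
  by rewrite -fsbig_seq ?enum_uniq// big_enum.
- exact: finite_finset.
- by move=> x y _ _ [w [[_ /= <-] [_ /= <-]]].
- by move=> x _; exact: measurableI.
Qed.

Lemma independent_bigcap (I : choiceType) (F : I -> set_system T) (r : seq I)
    (A : I -> set T) : mutually_independent P F -> uniq r ->
  (forall i, i \in r -> F i (A i)) ->
  P (\bigcap_(i in [set` r]) A i) = (\prod_(i <- r) P (A i))%E.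
Proof.
move=> ind ur FA.
have := ind [fset i in r]%fset A; rewrite (_ : [set` [fset i in r]%fset] = [set` r]); last first.
  by apply/seteqP; split=> i /=; rewrite inE.
move=> -> => [|i]; last by rewrite inE; exact: FA.
apply: perm_big; apply: uniq_perm => // i; by rewrite inE.
Qed.

End TotalProbability.

Section BernoulliModel.
Context {d : measure_display} {T : measurableType d} {R : realType}.
Variables (P : probability T R) (n : nat) (key : T -> 'I_n -> nat -> bool).
Hypothesis UB : unbiased_bernoulli P key.

Definition prefix_event i (s : seq bool) : set T :=
  [set w | addr (key w) 0 (size s) i == s].

Definition all_bits : set_system T := [set bit_event key x.1 x.2 | x in [set: 'I_n * nat]].

Lemma addr_enum (k : 'I_n -> nat -> bool) m i :
  addr k 0 m i = [seq k i (val r) | r <- enum 'I_m].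
Proof. by rewrite addrE /mkseq -val_enum_ord -map_comp. Qed.

Lemma prefix_event_bigcap i s : prefix_event i s = \bigcap_(l in [set` iota 0 (size s)])
  (if nth false s l then bit_event key i l else ~` bit_event key i l).
Proof.
apply/seteqP; split=> w /=; rewrite /prefix_event/= addrE.
  move=> /eqP <- l /=; rewrite mem_iota/= add0n => lm.
  rewrite size_mkseq in lm; rewrite nth_mkseq// add0n; case: ifPn => //.
  by move/negP.
move=> h; apply/eqP/(@eq_from_nth _ false); rewrite size_mkseq// => l ls.
rewrite nth_mkseq// add0n; have := h l; rewrite /= mem_iota ls => /(_ isT).
by case: ifPn => //= _ /negP/negPf.
Qed.

Lemma measurable_bit i l : measurable (bit_event key i l).
Proof. by case: UB. Qed.

Lemma probability_bitC i l : P (~` bit_event key i l) = (2^-1)%:E.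
Proof.
rewrite probability_setC; last exact: measurable_bit.
by case: UB => _ -> _ _; rewrite -EFinB; congr EFin; field.
Qed.

Lemma probability_prefix i s : P (prefix_event i s) = (2 ^- size s)%:E.
Proof.
case: UB => _ Pbit ind _; rewrite prefix_event_bigcap.
rewrite (independent_bigcap (ind i)) ?iota_uniq//.
  rewrite (eq_bigr (fun=> (2^-1)%:E)); last first.
    by move=> l _; case: ifP => _; [exact: Pbit|exact: probability_bitC].
  by rewrite prod_EFin big_const_seq count_predT size_iota iter_mulr_1 exprVn.
move=> l _; case: ifP => _; first by apply: sub_sigma_algebra.
by apply: sigma_algebraC; apply: sub_sigma_algebra.
Qed.

Lemma prefix_event_sigma i s : <<s range (bit_event key i) >> (prefix_event i s).
Proof.
pose S (g : {ffun 'I_(size s) -> bool}) := [seq g r | r <- enum 'I_(size s)] == s.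
have -> : prefix_event i s = [set w | S [ffun r => key w i (val r)]].
  have E w : addr (key w) 0 (size s) i =
      [seq [ffun r : 'I_(size s) => key w i (val r)] r | r <- enum 'I_(size s)].
    by rewrite addr_enum; apply: eq_map => r; rewrite ffunE.
  by apply/seteqP; split=> w; rewrite /prefix_event/S/= E.
apply: (@sigma_ffun _ _ _ _ S) => r.
by apply: sub_sigma_algebra; exists (val r).
Qed.

Lemma measurable_prefix i s : measurable (prefix_event i s).
Proof.
rewrite prefix_event_bigcap; apply: fin_bigcap_measurable => [|l _].
  exact: finite_seq.
by case: ifP => _; [|apply: measurableC]; exact: measurable_bit.
Qed.

Lemma independent_prefix (r : seq 'I_n) (A : 'I_n -> set T) : uniq r ->
  (forall k, exists s, A k = prefix_event k s \/ A k = ~` prefix_event k s) ->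
  P (\bigcap_(k in [set` r]) A k) = (\prod_(k <- r) P (A k))%E.
Proof.
case: UB => _ _ _ ind ur hA; apply: independent_bigcap ind ur _ => k _.
have [s [->|->]] := hA k; first exact: prefix_event_sigma.
by apply: sigma_algebraC; exact: prefix_event_sigma.
Qed.

(** Reads an address from a finite table of bits, which presents [agree] and [crowded] as functions
    of finitely many bits. *)
Definition gaddr m (g : {ffun 'I_n * 'I_m -> bool}) i := [seq g (i, r) | r <- enum 'I_m].

Lemma gaddrE m w i : gaddr [ffun x : 'I_n * 'I_m => key w x.1 (val x.2)] i = addr (key w) 0 m i.
Proof. by rewrite addr_enum /gaddr; apply: eq_map => r; rewrite ffunE. Qed.

Lemma agree_sigma m i k : <<s all_bits >> [set w | agree (key w) m i k].
Proof.
pose S (g : {ffun 'I_n * 'I_m -> bool}) := gaddr g i == gaddr g k.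
have -> : [set w | agree (key w) m i k] = [set w | S [ffun x => key w x.1 (val x.2)]].
  by apply/seteqP; split=> w /=; rewrite /S !gaddrE.
apply: (@sigma_ffun _ _ _ _ S) => -[j r].
by apply: sub_sigma_algebra; exists (j, val r).
Qed.

Lemma crowded_sigma m i : <<s all_bits >> [set w | crowded (key w) m i].
Proof.
pose S (g : {ffun 'I_n * 'I_m -> bool}) :=
  [exists k, (k != i) && (gaddr g k == gaddr g i)].
have -> : [set w | crowded (key w) m i] = [set w | S [ffun x => key w x.1 (val x.2)]].
  by apply/seteqP; split=> w /= /fintype.existsP[k h]; apply/fintype.existsP; exists k;
    move: h; rewrite !gaddrE.
apply: (@sigma_ffun _ _ _ _ S) => -[j r].
by apply: sub_sigma_algebra; exists (j, val r).
Qed.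

Lemma all_bits_measurable A : <<s all_bits >> A -> measurable A.
Proof.
apply: smallest_sub; first exact: sigma_algebra_measurable.
by move=> _ [[i l] _ <-]; exact: measurable_bit.
Qed.

Definition prefix_tuple m i w : m.-tuple bool := [tuple key w i (val r) | r < m].

Lemma prefix_tuple_event m i (s : m.-tuple bool) :
  prefix_tuple m i @^-1` [set s] = prefix_event i s.
Proof.
apply/seteqP; split=> w /=; rewrite /prefix_event/= size_tuple addr_enum.
  by move=> <-; apply/eqP; rewrite /prefix_tuple /= enumT.
by move=> /eqP h; apply: val_inj => /=; rewrite -h enumT.
Qed.

(** Conditioning on the first [m] bits of one key: once they are frozen to [s], a coincidence with
    [i] only concerns the other keys, and independence applies. *)
Lemma total_prefix m i A : measurable A -> forall x : R,
  (forall s : m.-tuple bool, P (A `&` prefix_event i s) = (2 ^- m * x)%:E) -> P A = x%:E.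
Proof.
move=> mA x h; rewrite (total_probability P mA (f := prefix_tuple m i)); last first.
  by move=> s; rewrite prefix_tuple_event; exact: measurable_prefix.
under eq_bigr do rewrite prefix_tuple_event h.
rewrite sumEFin sumr_const card_tuple card_bool -[_ *+ _]mulr_natl natrX mulrA.
by rewrite mulfV ?mul1r// expf_neq0// pnatr_eq0.
Qed.

Lemma probability_agree m i k : i != k -> P [set w | agree (key w) m i k] = (2 ^- m)%:E.
Proof.
move=> ik; apply: (total_prefix (m := m) (i := i)); first by apply: all_bits_measurable; exact: agree_sigma.
move=> s; rewrite (_ : _ `&` _ = \bigcap_(j in [set` [:: i; k]]) prefix_event j s); last first.
  apply/seteqP; split=> w /=; rewrite /prefix_event/= size_tuple.
    move=> [/eqP ag /eqP is_] j /=; rewrite !inE => /orP[] /eqP ->; first by rewrite is_.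
    by rewrite -ag is_.
  move=> h; have hi := h i; have hk := h k; move: hi hk; rewrite /= !inE !eqxx orbT.
  by move=> /(_ isT) /eqP hi /(_ isT) /eqP hk; split; apply/eqP; rewrite ?hi ?hk.
rewrite independent_prefix; last 2 first.
- by rewrite /= inE ik.
- by move=> j; exists s; left.
by rewrite !big_cons big_nil !probability_prefix size_tuple mule1 -EFinM.
Qed.

Lemma probability_crowded m i : P [set w | crowded (key w) m i] = (1 - (1 - 2 ^- m) ^+ n.-1)%:E.
Proof.
have mC : measurable [set w | crowded (key w) m i] by apply: all_bits_measurable; exact: crowded_sigma.
rewrite -[X in P X]setCK probability_setC; last exact: measurableC.
suff -> : P (~` [set w | crowded (key w) m i]) = ((1 - 2 ^- m) ^+ n.-1)%:E by rewrite -EFinB.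
apply: (total_prefix (m := m) (i := i)); first exact: measurableC.
(* When [i] has prefix [s], it is not crowded exactly when each of the [n - 1] other keys avoids
   [s]. *)
move=> s; rewrite (_ : _ `&` _ = \bigcap_(k in [set` enum 'I_n])
    (if k == i then prefix_event k s else ~` prefix_event k s)); last first.
  apply/seteqP; split=> w /=; rewrite /prefix_event/= size_tuple.
    move=> [/negP nc /eqP is_] k _; case: eqP => [->|/eqP ki] /=; first by rewrite is_.
    move=> /eqP ks; move/negP: nc; apply; apply/fintype.existsP; exists k.
    by rewrite ki /agree ks is_ eqxx.
  move=> h; have := h i; rewrite /= mem_enum eqxx /= => /(_ isT) /eqP is_.
  split; last by rewrite is_.
  move=> /fintype.existsP[k /andP[ki /eqP ag]]; have := h k.
  by rewrite /= mem_enum (negPf ki)/= ag is_ eqxx => /(_ isT).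
rewrite independent_prefix ?enum_uniq//; last first.
  by move=> k; exists s; case: ifP => _; [left|right].
rewrite big_enum/= (bigD1 i)//= eqxx probability_prefix size_tuple.
rewrite (eq_bigr (fun=> (1 - 2 ^- m)%:E)); last first.
  move=> k /negPf ->; rewrite probability_setC; last exact: measurable_prefix.
  by rewrite probability_prefix size_tuple -EFinB.
by rewrite prod_EFin prodr_const cardC1 card_ord -EFinM.
Qed.

End BernoulliModel.

(** * Calculus on the real line *)

Section Derivation.
Context {R : realType}.
Implicit Types (f g : R -> R) (x k : R).

Lemma deriveR_id x : is_derive x 1 (fun y : R => y) 1.
Proof. exact: is_derive_id. Qed.

Lemma deriveR_cst x k : is_derive x 1 (fun _ : R => k) 0.
Proof. exact: is_derive_cst. Qed.

Lemma deriveR_add f g x df dg : is_derive x 1 f df -> is_derive x 1 g dg ->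
  is_derive x 1 (fun y => f y + g y) (df + dg).
Proof. by move=> ? ?; exact: is_deriveD. Qed.

Lemma deriveR_sub f g x df dg : is_derive x 1 f df -> is_derive x 1 g dg ->
  is_derive x 1 (fun y => f y - g y) (df - dg).
Proof. by move=> ? ?; exact: is_deriveB. Qed.

Lemma deriveR_opp f x df : is_derive x 1 f df -> is_derive x 1 (fun y => - f y) (- df).
Proof. by move=> ?; exact: is_deriveN. Qed.

Lemma deriveR_mul f g x df dg : is_derive x 1 f df -> is_derive x 1 g dg ->
  is_derive x 1 (fun y => f y * g y) (f x * dg + g x * df).
Proof. by move=> ? ?; exact: is_deriveM. Qed.

Lemma deriveR_inv f x df : is_derive x 1 f df -> f x != 0 ->
  is_derive x 1 (fun y => (f y)^-1) (- (f x) ^- 2 * df).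
Proof. by move=> ? ?; exact: is_deriveV. Qed.

Lemma deriveR_exp f x df n : is_derive x 1 f df ->
  is_derive x 1 (fun y => f y ^+ n) (n%:R * f x ^+ n.-1 * df).
Proof.
move=> dfx; have := @is_deriveX _ _ f n x 1 df dfx.
by rewrite exprfctE.
Qed.

Lemma deriveR_comp f g x df dg : is_derive x 1 f df -> is_derive (f x) 1 g dg ->
  is_derive x 1 (fun y => g (f y)) (dg * df).
Proof. by move=> ? ?; exact: is_derive1_comp. Qed.

Lemma deriveR_expR f x df : is_derive x 1 f df ->
  is_derive x 1 (fun y => expR (f y)) (expR (f x) * df).
Proof. by move=> ?; exact: deriveR_comp. Qed.

Lemma deriveR_sin f x df : is_derive x 1 f df ->
  is_derive x 1 (fun y => sin (f y)) (cos (f x) * df).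
Proof. by move=> ?; exact: deriveR_comp. Qed.

Lemma deriveR_cos f x df : is_derive x 1 f df ->
  is_derive x 1 (fun y => cos (f y)) (- sin (f x) * df).
Proof. by move=> ?; exact: deriveR_comp. Qed.

Lemma deriveR_ln f x df : is_derive x 1 f df -> 0 < f x ->
  is_derive x 1 (fun y => ln (f y)) ((f x)^-1 * df).
Proof. by move=> ? ?; apply: deriveR_comp; exact: is_derive1_ln. Qed.

Lemma deriveR_sum (I : Type) (r : seq I) (F : I -> R -> R) (dF : I -> R) x :
  (forall i, is_derive x 1 (F i) (dF i)) ->
  is_derive x 1 (fun y => \sum_(i <- r) F i y) (\sum_(i <- r) dF i).
Proof.
move=> FdF; elim: r => [|i r IHr].
  by under eq_fun do rewrite big_nil; rewrite big_nil; exact: deriveR_cst.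
by under eq_fun do rewrite big_cons; rewrite big_cons; exact: deriveR_add.
Qed.

Lemma deriveR_eq f x df df' : is_derive x 1 f df -> df = df' -> is_derive x 1 f df'.
Proof. by move=> + <-. Qed.

Lemma deriveR_ext f g x df : (forall y, f y = g y) -> is_derive x 1 g df ->
  is_derive x 1 f df.
Proof. by move=> /funext ->. Qed.

(** By the mean value theorem, [g - f] and [g + f] are both nondecreasing. *)
Lemma ler_dist_deriveR f g f' g' a b : a <= b ->
  (forall x, a <= x <= b -> is_derive x 1 f (f' x)) ->
  (forall x, a <= x <= b -> is_derive x 1 g (g' x)) ->
  (forall x, a <= x <= b -> `|f' x| <= g' x) ->
  `|f b - f a| <= g b - g a.
Proof.
move=> ab df dg fg.
have incr (h h' : R -> R) : (forall x, a <= x <= b -> is_derive x 1 h (h' x)) ->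
    (forall x, a <= x <= b -> 0 <= h' x) -> h a <= h b.
  move=> dh h'0.
  have [||c cab hE] := @MVT_segment R h h' a b ab.
  - by move=> x; rewrite in_itv/= => /andP[/ltW ? /ltW ?]; apply: dh; apply/andP.
  - apply: derivable_within_continuous => x; rewrite in_itv/= => xab.
    by have := dh _ xab => -[].
  by rewrite -subr_ge0 hE mulr_ge0 ?subr_ge0// h'0//; rewrite in_itv in cab.
have fgN : g a - f a <= g b - f b.
  apply: (incr (fun x => g x - f x) (fun x => g' x - f' x)) => x xab.
    by apply: deriveR_sub; [exact: dg|exact: df].
  by rewrite subr_ge0 (le_trans _ (fg _ xab))// ler_norm.
have fgD : g a + f a <= g b + f b.
  apply: (incr (fun x => g x + f x) (fun x => g' x + f' x)) => x xab.
    by apply: deriveR_add; [exact: dg|exact: df].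
  by have := fg _ xab; rewrite ler_norml => /andP[+ _]; rewrite -subr_ge0 opprK addrC.
by rewrite ler_norml; apply/andP; split; lra.
Qed.

End Derivation.

(** The derivative is an existential variable filled in by the rules, which are stated for
    eta-expanded functions and chosen by syntax. The constant rule comes first, so that a subterm
    free of the variable is not taken apart. Sign and nonvanishing conditions are left as goals. *)
Ltac derive := repeat (first
  [ notypeclasses refine (deriveR_cst _ _) | notypeclasses refine (deriveR_id _)
  | notypeclasses refine (deriveR_sub _ _) | notypeclasses refine (deriveR_add _ _)
  | notypeclasses refine (deriveR_opp _) | notypeclasses refine (deriveR_mul _ _)
  | notypeclasses refine (deriveR_exp _ _) | notypeclasses refine (deriveR_inv _ _)
  | notypeclasses refine (deriveR_expR _) | notypeclasses refine (deriveR_sin _)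
  | notypeclasses refine (deriveR_cos _) | notypeclasses refine (deriveR_ln _ _) ]).

Ltac derive_eq := notypeclasses refine (deriveR_eq _ _); [derive | cbv beta].

(** * Primitives on the positive half-line and exponential tails *)

Section Primitive.
Context {R : realType}.
Notation mu := (@lebesgue_measure R).
Implicit Types (f : R -> R).

Lemma measurable_pos_continuous f : (forall x : R, 0 < x -> {for x, continuous f}) ->
  measurable_fun (`]0, +oo[ : set R) f.
Proof.
move=> cf; apply: open_continuous_measurable_fun; first exact: interval_open.
by move=> x; rewrite inE/= in_itv/= andbT; exact: cf.
Qed.

Definition primitive f (z : R) := \int[mu]_(x in `]0, z]) f x.

Lemma integrable_itvoc f (M u : R) : (forall x : R, 0 < x -> {for x, continuous f}) ->
  (forall x : R, 0 < x <= u -> `|f x| <= M) -> mu.-integrable `]0, u] (EFin \o f).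
Proof.
move=> cf fM; apply: measurable_bounded_integrable => //=.
- by rewrite lebesgue_measure_itv/=; case: ifPn => // _; rewrite -EFinB ltry.
- apply: measurable_funS (measurable_pos_continuous cf) => //.
  by apply: subset_itvl; rewrite bnd_simp.
- exists `|M|; split; first by rewrite num_real.
  move=> N MN x/=; rewrite in_itv/= => xu.
  by rewrite (le_trans (fM _ xu))// (le_trans (ler_norm _))// ltW.
Qed.

(** The fundamental theorem is applied on []0, z + 1]], to have [z] in the interior. The bound may
    depend on the endpoint, since the Beta integrand grows beyond 1. *)
Lemma deriveR_primitive f (M : R -> R) (z : R) : (forall x : R, 0 < x -> {for x, continuous f}) ->
  (forall u x : R, 0 < x <= u -> `|f x| <= M u) -> 0 < z ->
  is_derive z 1 (primitive f) (f z).
Proof.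
move=> cf fM z0; have zz1 : z < z + 1 by rewrite ltrDl.
have intf : mu.-integrable `]0, z + 1] (EFin \o f).
  by apply: (@integrable_itvoc _ (M (z + 1))) => // x; exact: fM.
have [|df <-] := continuous_FTC1 zz1 intf _ (cf _ z0); first by [].
by rewrite derive1E; exact: derivableP.
Qed.

Lemma le_primitive f (M z : R) : (forall x : R, 0 < x -> {for x, continuous f}) ->
  (forall x : R, 0 < x <= z -> `|f x| <= M) -> 0 <= z ->
  `|primitive f z| <= M * z.
Proof.
move=> cf fM z0; have intf := integrable_itvoc cf fM.
apply: le_trans (le_normr_Rintegral _ intf) _ => //.
apply: (@le_trans _ _ (\int[mu]_(x in `]0, z]) M)).
  apply: le_Rintegral => //=.
  - by move/integrable_norm: intf.
  - apply: measurable_bounded_integrable => //=.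
      by rewrite lebesgue_measure_itv/=; case: ifPn => // _; rewrite -EFinB ltry.
    exact: bounded_cst.
have -> : \int[mu]_(_ in `]0, z]) M = M * fine (lebesgue_measure (`]0, z] : set R)) by rewrite Rintegral_cst.
rewrite lebesgue_measure_itv/= lte_fin.
by move: z0; rewrite le_eqVlt => /predU1P[<-|z0]; rewrite ?ltxx ?z0 /= ?mulr0 ?subr0.
Qed.

Lemma integral_expRN (z : R) : (\int[mu]_(x in `[z, +oo[) (expR (- x))%:E = (expR (- z))%:E)%E.
Proof.
rewrite (@ge0_continuous_FTC2y _ _ (fun x => - expR (- x)) _ 0).
- by rewrite -EFinB opprK add0r.
- by move=> x _; exact: expR_ge0.
- apply: continuous_subspaceT => x.
  by apply: continuous_comp; [exact: opp_continuous|exact: continuous_expR].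
- by rewrite -[X in _ --> X]oppr0; apply: cvgN; exact: cvgr_expR.
- move=> x _.
  have : is_derive x 1 (fun y : R => - expR (- y)) (- (expR (- x) * - 1)) by derive.
  by case.
- apply: cvg_at_right_filter; apply: cvgN.
  by apply: continuous_comp; [exact: opp_continuous|exact: continuous_expR].
- move=> x _; rewrite derive1E.
  have : is_derive x 1 (fun y : R => - expR (- y)) (- (expR (- x) * - 1)) by derive.
  by case=> _ ->; rewrite mulrN1 opprK.
Qed.

Lemma integrable_expRN (z : R) : mu.-integrable `[z, +oo[ (fun x => (expR (- x))%:E).
Proof.
apply/integrableP; split.
  apply/measurable_EFinP; apply: measurable_funTS; apply: continuous_measurable_fun => x.
  by apply: continuous_comp; [exact: opp_continuous|exact: continuous_expR].
under eq_integral do rewrite gee0_abs ?lee_fin ?expR_ge0//.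
by rewrite integral_expRN ltry.
Qed.

Lemma integrable_le_expRN f : (forall x : R, 0 < x -> {for x, continuous f}) ->
  (forall x : R, 0 < x -> `|f x| <= expR (- x)) -> mu.-integrable `]0, +oo[ (EFin \o f).
Proof.
move=> cf fM.
apply: (@le_integrable _ _ _ mu _ _ (EFin \o f) (EFin \o (fun x => expR (- x)))) => //=.
- by apply/measurable_EFinP; exact: measurable_pos_continuous.
- move=> x; rewrite in_itv/= andbT => x0; rewrite lee_fin.
  by rewrite [leRHS]ger0_norm ?expR_ge0// fM.
- apply: integrableS (integrable_expRN 0) => //.
  by apply: subset_itvr; rewrite bnd_simp.
Qed.

Lemma primitive_tail f (z : R) : (forall x : R, 0 < x -> {for x, continuous f}) ->
  (forall x : R, 0 < x -> `|f x| <= expR (- x)) -> 0 < z ->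
  `|\int[mu]_(x in `]0, +oo[) f x - primitive f z| <= expR (- z).
Proof.
move=> cf fM z0.
have intf := integrable_le_expRN cf fM.
have sub : `]z, +oo[ `<=` (`]0, +oo[ : set R).
  by apply: subset_itvr; rewrite bnd_simp ltW.
have -> : [set` `]0, +oo[] = [set` `]0, z]] `|` [set` `]z, +oo[] :> set R.
  apply/seteqP; split=> x /=; rewrite !in_itv/= !andbT.
    by move=> ->/=; case: (leP x z); [left|right].
  by case=> [/andP[]//|]; exact: lt_trans.
rewrite Rintegral_setU//=; first last.
- apply/disj_setPS => x [] /=; rewrite !in_itv/= andbT => /andP[_ xz] zx.
  by move: (lt_le_trans zx xz); rewrite ltxx.
- apply: integrableS intf => //=; first exact: measurableU.
  by move=> x [|/sub//]; rewrite /= !in_itv/= andbT => /andP[].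
rewrite /primitive addrAC subrr add0r.
have intfz : mu.-integrable `]z, +oo[ (EFin \o f).
  by apply: integrableS intf.
have inte : mu.-integrable `]z, +oo[ (fun x => (expR (- x))%:E).
  by apply: integrableS (integrable_expRN z) => //; apply: subset_itvr; rewrite bnd_simp.
apply: le_trans (le_normr_Rintegral _ intfz) _ => //.
apply: le_trans (_ : \int[mu]_(x in `]z, +oo[) expR (- x) <= _).
  apply: le_Rintegral => //=; first by move/integrable_norm: intfz.
  by move=> x; rewrite in_itv/= andbT => zx; apply: fM; exact: lt_trans zx.
rewrite Rintegral_itv_obnd_cbnd; last exact: inte.
by rewrite /Rintegral integral_expRN.
Qed.

End Primitive.

(** * Real and imaginary parts of the Gamma function on the line of real part 1 *)

Section Oscillating.
Context {R : realType}.
Notation mu := (@lebesgue_measure R).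
Implicit Types (c s : R -> R) (w : R).

Definition osc c w y : R := c (w * ln y) * expR (- y).
(** For [c] equal to [cos] or [sin], the real or imaginary part of Gamma(1 + i w). *)
Definition osc_integral c w := \int[mu]_(y in `]0, +oo[) osc c w y.

Lemma osc_continuous c w : continuous c ->
  forall y : R, 0 < y -> {for y, continuous (osc c w)}.
Proof.
move=> cc y y0; apply: continuousM.
  apply: (@continuous_comp _ _ _ (fun y => w * ln y) c); last exact: cc.
  by apply: continuousM; [exact: cvg_cst|exact: continuous_ln].
apply: (@continuous_comp _ _ _ (fun y : R => - y) expR); last exact: continuous_expR.
exact: opp_continuous.
Qed.

Lemma osc_le c w : (forall x : R, `|c x| <= 1) -> forall y, `|osc c w y| <= expR (- y).
Proof. by move=> c1 y; rewrite normrM [X in _ * X]ger0_norm ?expR_ge0// ler_piMl ?expR_ge0. Qed.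

Lemma osc_le1 c w : (forall x : R, `|c x| <= 1) -> forall y, 0 < y -> `|osc c w y| <= 1.
Proof.
move=> c1 y y0; apply: le_trans (osc_le w c1 y) _.
by rewrite expR_le1 oppr_le0 ltW.
Qed.

Lemma deriveR_primitive_osc c w (z : R) : continuous c -> (forall x : R, `|c x| <= 1) -> 0 < z ->
  is_derive z 1 (primitive (osc c w)) (osc c w z).
Proof.
move=> cc c1 z0; apply: (@deriveR_primitive _ _ (fun=> 1)) => //.
  exact: osc_continuous.
by move=> u x /andP[x0 _]; exact: osc_le1.
Qed.

Lemma le_primitive_osc c w (z : R) : continuous c -> (forall x : R, `|c x| <= 1) -> 0 <= z ->
  `|primitive (osc c w) z| <= z.
Proof.
move=> cc c1 z0; rewrite -[leRHS]mul1r; apply: le_primitive => //.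
  exact: osc_continuous.
by move=> x /andP[x0 _]; exact: osc_le1.
Qed.

Lemma osc_integral_tail c w (z : R) : continuous c -> (forall x : R, `|c x| <= 1) -> 0 < z ->
  `|osc_integral c w - primitive (osc c w) z| <= expR (- z).
Proof.
move=> cc c1 z0; apply: primitive_tail => //; first exact: osc_continuous.
by move=> x _; exact: osc_le.
Qed.

Lemma osc_integral_le2 c w : continuous c -> (forall x : R, `|c x| <= 1) ->
  `|osc_integral c w| <= 2.
Proof.
move=> cc c1.
have := osc_integral_tail w cc c1 (@ltr01 R).
have := le_primitive_osc w cc c1 (@ler01 R).
have : expR (- 1 : R) <= 1 by rewrite expR_le1; lra.
move: (primitive _ _) (osc_integral _ _) => p i; rewrite !ler_norml.
by move=> ? /andP[? ?] /andP[? ?]; apply/andP; split; lra.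
Qed.

(* Integration by parts, in the form of a bound on the derivative of
   [primitive (osc c w) + k w primitive (osc s w) - y exp (- y) c (w ln y)]. *)
Lemma osc_integral_decay c s (k : R) w : `|k| = 1 ->
  (forall x : R, is_derive x 1 c (k * s x)) -> continuous c -> continuous s ->
  (forall x : R, `|c x| <= 1) -> (forall x : R, `|s x| <= 1) ->
  `|w * osc_integral s w| <= 9.
Proof.
move=> k1 dc cc cs c1 s1.
(* Both cuts absorb the factor [w]: near 0 the primitives are at most [a], with [b * a = 1]; beyond
   [b] the tails are at most [exp(-b)], with [b * exp(-b) <= 1]. *)
pose b := 1 + `|w|; pose a := b^-1.
have b1 : 1 <= b by rewrite lerDl.
have a0 : 0 < a by rewrite invr_gt0; lra.
have ab : a * b = 1 by rewrite mulVf//; lra.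
have a1 : a <= 1 by rewrite invf_le1//; lra.
pose g (y : R) := y * osc c w y.
pose h y := primitive (osc c w) y + k * w * primitive (osc s w) y - g y.
(* Here [g' = osc c w + k w osc s w - g], so [h' = g], in which the factor [w] no longer appears. *)
have dh y : a <= y <= b -> is_derive y 1 h (y * osc c w y).
  move=> /andP[ay _]; have y0 : 0 < y by exact: lt_le_trans ay.
  apply: deriveR_eq.
    apply: deriveR_sub; first apply: deriveR_add.
    - exact: deriveR_primitive_osc.
    - apply: deriveR_mul.
      exact: deriveR_primitive_osc.
    - apply: deriveR_mul.
      apply: deriveR_mul.
      exact: deriveR_comp (deriveR_mul (deriveR_cst y w) (deriveR_ln (deriveR_id y) y0)) (dc _).
  by rewrite /osc /=; field; rewrite gt_eqF.
have dg y : a <= y <= b -> is_derive y 1 (fun y : R => - ((1 + y) * expR (- y))) (y * expR (- y)).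
  by move=> _; derive_eq; ring.
have hab : `|h b - h a| <= 1.
  apply: le_trans (ler_dist_deriveR _ dh dg _) _.
  - lra.
  - move=> x /andP[ax _]; rewrite normrM ger0_norm; last lra.
    by rewrite ler_wpM2l ?osc_le//; lra.
  - rewrite opprK addrC lerBlDr (le_trans (_ : _ <= 1)) ?lerDl//; last first.
      by rewrite mulr_ge0 ?expR_ge0//; lra.
    by rewrite expRN ler_pdivrMr ?expR_gt0// mul1r expR_ge1Dx.
have be : b * expR (- b) <= 1.
  by rewrite expRN ler_pdivrMr ?expR_gt0// mul1r (le_trans _ (expR_ge1Dx _))// lerDr.
have eb1 : expR (- b) <= 1 by rewrite expR_le1; lra.
have e0 := expR_ge0 (- b).
have ga : `|g a| <= 1.
  rewrite normrM gtr0_norm// mulr_ile1//; first exact: ltW.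
  exact: osc_le1.
have gb : `|g b| <= 1.
  rewrite normrM gtr0_norm; last lra.
  by apply: le_trans be; rewrite ler_wpM2l ?osc_le//; lra.
have kw (p : R) : `|k * w * p| <= b * `|p|.
  by rewrite 2!normrM k1 mul1r ler_wpM2r// lerDr.
have Ha : `|h a| <= 3.
  have := le_primitive_osc w cc c1 (ltW a0).
  have := le_trans (kw _) (ler_wpM2l (_ : 0 <= b) (le_primitive_osc w cs s1 (ltW a0))).
  have -> : b * a = 1 by rewrite mulrC.
  move=> /(_ ltac:(lra)); rewrite /h; move: ga.
  move: (_ * primitive (osc s w) a) (primitive (osc c w) a) (g a) => p q r.
  rewrite !ler_norml => /andP[? ?] /andP[? ?] /andP[? ?].
  by apply/andP; split; lra.
have b0 : 0 < b by lra.
(* The 9 is 4 for [h b], 1 for [g b], 1 for each of the two tails and 2 for the integral of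
   [osc c w]. *)
have Tc := osc_integral_tail w cc c1 b0.
have Ts := le_trans (kw _) (ler_wpM2l (ltW b0) (osc_integral_tail w cs s1 b0)).
have Ic := osc_integral_le2 w cc c1.
have <- : `|k * w * osc_integral s w| = `|w * osc_integral s w|.
  by rewrite -mulrA normrM k1 mul1r.
move: Ts Tc Ic hab Ha gb be; rewrite mulrBr /h.
move: (_ * osc_integral s w) (osc_integral c w).
move: (_ * primitive (osc s w) b) (primitive (osc c w) b) (g b).
move: (primitive (osc c w) a + _ - _) => ha p q r x y.
rewrite !ler_norml => /andP[? ?] /andP[? ?] /andP[? ?] /andP[? ?] /andP[? ?] /andP[? ?] ?.
by apply/andP; split; lra.
Qed.

End Oscillating.

(** * Comparison of Beta and Gamma integrals *)

Section Beta.
Context {R : realType}.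
Implicit Types (w : R).

Definition beta_osc (m : nat) w (y : R) : R :=
  m.+1%:R * (1 - y) ^+ m * sin (w * ln y).

Lemma beta_osc_continuous m w (y : R) : 0 < y -> {for y, continuous (beta_osc m w)}.
Proof.
move=> y0; suff [D] : exists D, is_derive y 1 (beta_osc m w) D.
  by case=> /derivable1_diffP/differentiable_continuous.
by rewrite /beta_osc; eexists; derive.
Qed.

Lemma beta_osc_le m w (u x : R) : 0 < x <= u -> `|beta_osc m w x| <= m.+1%:R * (1 + u) ^+ m.
Proof.
move=> /andP[x0 xu]; rewrite /beta_osc !normrM normr_nat -mulrA ler_wpM2l//.
rewrite -[leRHS]mulr1 ler_pM ?sin_max// normrX lerXn2r ?nnegrE//; first lra.
by rewrite ler_norml; apply/andP; split; lra.
Qed.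

Lemma beta_osc_le_nat m w (x : R) : 0 < x <= 1 -> `|beta_osc m w x| <= m.+1%:R.
Proof.
move=> /andP[x0 x1]; rewrite /beta_osc !normrM normr_nat -mulrA ler_piMr//.
rewrite mulr_ile1 ?sin_max// normrX exprn_ile1//.
by rewrite ler_norml; apply/andP; split; lra.
Qed.

Lemma deriveR_primitive_beta m w (z : R) : 0 < z ->
  is_derive z 1 (primitive (beta_osc m w)) (beta_osc m w z).
Proof.
apply: deriveR_primitive; first exact: beta_osc_continuous.
by move=> u x; exact: beta_osc_le.
Qed.

Lemma le_primitive_beta m w (z : R) : 0 < z <= 1 ->
  `|primitive (beta_osc m w) z| <= m.+1%:R * z.
Proof.
move=> /andP[z0 z1]; apply: le_primitive => [||]; [exact: beta_osc_continuous| |exact: ltW].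
by move=> x /andP[x0 xz]; apply: beta_osc_le_nat; rewrite x0 (le_trans xz).
Qed.

(** With [a = exp(-z)] and [b = 1 - z], write [a^(m+1) - b^(m+1) = a^m (a - b) + b (a^m - b^m)]; one
    step costs [a - b <= z^2 <= 4 a z^2]. Keeping the factor [exp(-m z)] confines the error to [z]
    of order [1/m]. *)
Lemma expRN_Xsub (m : nat) (z : R) : 0 <= z <= 1 ->
  0 <= expR (- (m%:R * z)) - (1 - z) ^+ m <= 4 * m%:R * z ^+ 2 * expR (- (m%:R * z)).
Proof.
move=> /andP[z0 z1]; have eE k : expR (- (k%:R * z)) = expR (- z) ^+ k.
  by rewrite -mulrN expRM_natl.
have ez : 1 - z <= expR (- z) by have := expR_ge1Dx (- z).
have ez2 : expR (- z) <= 1 - z + z ^+ 2.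
  rewrite expRN -[leLHS]mul1r ler_pdivrMr ?expR_gt0//.
  apply: (@le_trans _ _ ((1 - z + z ^+ 2) * (1 + z))).
    have z3 : 0 <= z ^+ 3 by rewrite exprn_ge0.
    have -> : (1 - z + z ^+ 2) * (1 + z) = 1 + z ^+ 3 by ring.
    by rewrite lerDl.
  by rewrite ler_wpM2l ?expR_ge1Dx//; nra.
(* On the unit interval [exp(-z) = exp(-z/2)^2 >= (1 - z/2)^2 >= 1/4]. *)
have e4 : 1 <= 4 * expR (- z).
  have -> : - z = 2%:R * (- (z / 2)) by field.
  rewrite expRM_natl.
  by have := expR_ge1Dx (- (z / 2)); nra.
rewrite eE; apply/andP; split.
  by rewrite subr_ge0 lerXn2r// nnegrE; [lra|exact: expR_ge0].
elim: m => [|m IHm]; first by rewrite !expr0; lra.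
rewrite -[m.+1%:R]natr1 ![expR _ ^+ m.+1]exprS [(1 - z) ^+ m.+1]exprS.
have bm : 0 <= (1 - z) ^+ m by rewrite exprn_ge0//; lra.
have am : 0 <= expR (- z) ^+ m by rewrite exprn_ge0// expR_ge0.
have e0 := expR_ge0 (- z).
move: (expR (- z)) ((1 - z) ^+ m) (expR (- z) ^+ m) ez ez2 e4 IHm bm am e0
  => a B A ez ez2 e4 IHm bm am e0.
have -> : a * A - (1 - z) * B = A * (a - (1 - z)) + (1 - z) * (A - B) by ring.
have -> : 4 * (m%:R + 1) * z ^+ 2 * (a * A) =
  A * (4 * a * z ^+ 2) + a * (4 * m%:R * z ^+ 2 * A) by ring.
apply: lerD.
  by rewrite ler_wpM2l//; nra.
have K0 : 0 <= 4 * m%:R * z ^+ 2 * A by rewrite !mulr_ge0// exprn_ge0.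
apply: (@le_trans _ _ ((1 - z) * (4 * m%:R * z ^+ 2 * A))).
  by rewrite ler_wpM2l//; lra.
by rewrite ler_wpM2r.
Qed.

(** The substitution [y = (m+2) z] turns [exp(-y) dy] into the second density. The majorant is an
    exponential times a quadratic, so it has a primitive in closed form. *)
Lemma beta_gamma_density (m : nat) (z : R) : 0 <= z <= 1 ->
  `|m.+1%:R * (1 - z) ^+ m - m.+2%:R * expR (- (m.+2%:R * z))| <=
  expR (- (m%:R * z)) * (4 * m.+1%:R * m%:R * z ^+ 2 + 2 * m.+1%:R * z + 1).
Proof.
move=> z01; have /andP[ge0 le4] := expRN_Xsub m z01.
have -> : - (m.+2%:R * z) = - (m%:R * z) + - (2 * z) by rewrite -[m.+2%:R]natr1 -[m.+1%:R]natr1; ring.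
have e1 := expR_ge1Dx (- (2 * z)).
have e2 : expR (- (2 * z)) <= 1 by rewrite expR_le1; lra.
have e3 := expR_ge0 (- (2 * z)).
have a0 := expR_ge0 (- (m%:R * z)).
rewrite expRD -[m.+2%:R]natr1; move: ge0 le4 e1 e2 e3 a0.
have N0 : 0 <= m.+1%:R :> R by [].
move: (expR (- (2 * z))) (expR (- (m%:R * z))) ((1 - z) ^+ m) (m.+1%:R : R) N0
  => e A B N N0 ge0 le4 e1 e2 e3 a0.
have -> : N * B - (N + 1) * (A * e) = A * (N * (1 - e) - e) - N * (A - B) by ring.
apply: le_trans (ler_normB _ _) _; rewrite !normrM.
rewrite (ger0_norm a0) (ger0_norm ge0) (ger0_norm N0).
have h1 : `|N * (1 - e) - e| <= 2 * N * z + 1.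
  by rewrite ler_norml; apply/andP; split; nra.
have h2 := ler_wpM2l a0 h1.
have h3 := ler_wpM2l N0 le4.
by apply: le_trans (lerD h2 h3) _; rewrite le_eqVlt; apply/orP; left; apply/eqP; ring.
Qed.

(** The integral of [exp(-y) sin(w (ln y - ln n))], with the sine expanded so that [n] leaves the
    integral. *)
Definition gamma_osc (n w : R) : R :=
  cos (w * ln n) * osc_integral sin w - sin (w * ln n) * osc_integral cos w.

Lemma beta_gamma (m : nat) w : (0 < m)%N ->
  `|primitive (beta_osc m w) 1 - gamma_osc m.+2%:R w| <= 100 / m%:R.
Proof.
move=> m0; set n : R := m.+2%:R; set N : R := m.+1%:R; set M : R := m%:R.
have M1 : 1 <= M by rewrite ler1n.
have NE : N = M + 1 by rewrite /N -[m.+1%:R]natr1.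
have nE : n = M + 2 by rewrite /n -[m.+2%:R]natr1 -[m.+1%:R]natr1 -addrA.
have n0 : 0 < n by lra.
pose D z := primitive (beta_osc m w) z -
  (cos (w * ln n) * primitive (osc sin w) (n * z)
   - sin (w * ln n) * primitive (osc cos w) (n * z)).
(* [K] and the coefficient [10 N / M] are solved for so that [B'] is the majorant of
   [beta_gamma_density]. *)
pose K := (1 + 10 * N / M) / M.
pose B z := - (expR (- (M * z)) * (4 * N * z ^+ 2 + 10 * N / M * z + K)).
(* The cut keeps [ln z] away from 0; below it the primitives contribute at most
   [N a + 2 n a = O(1/n)]. *)
pose a := n ^- 2.
have a0 : 0 < a by rewrite invr_gt0 exprn_gt0.
have a1 : a <= 1 by rewrite invf_le1 ?exprn_gt0//; nra.
have M0 : M != 0 by rewrite gt_eqF//; lra.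
have dD z : a <= z <= 1 ->
    is_derive z 1 D ((N * (1 - z) ^+ m - n * expR (- (n * z))) * sin (w * ln z)).
  move=> /andP[az _]; have z0 : 0 < z by exact: lt_le_trans az.
  have dz : is_derive z 1 (fun z => n * z) n by derive_eq; ring.
  have nz : 0 < n * z by rewrite mulr_gt0.
  have dsin := deriveR_comp dz (deriveR_primitive_osc w (@continuous_sin R) (@sin_max R) nz).
  have dcos := deriveR_comp dz (deriveR_primitive_osc w (@continuous_cos R) (@cos_max R) nz).
  apply: deriveR_eq (deriveR_sub (deriveR_primitive_beta m w z0)
    (deriveR_sub (deriveR_mul (deriveR_cst z (cos (w * ln n))) dsin)
                 (deriveR_mul (deriveR_cst z (sin (w * ln n))) dcos))) _.
  have lnz : w * ln (n * z) = w * ln n + w * ln z by rewrite lnM ?posrE// mulrDr.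
  rewrite /osc /beta_osc lnz sinD cosD -/N.
  have := cos2Dsin2 (w * ln n); move: (cos (w * ln n)) (sin (w * ln n)) => C S CS.
  set Ps := primitive _ _; set Pc := primitive _ _.
  transitivity (N * (1 - z) ^+ m * sin (w * ln z)
    - n * expR (- (n * z)) * sin (w * ln z) * (C ^+ 2 + S ^+ 2)); first by ring.
  by rewrite CS; ring.
have dB z : a <= z <= 1 ->
    is_derive z 1 B (expR (- (M * z)) * (4 * N * M * z ^+ 2 + 2 * N * z + 1)).
  by move=> _; rewrite /B; derive_eq; rewrite /K; field.
have DB : `|D 1 - D a| <= B 1 - B a.
  apply: ler_dist_deriveR a1 dD dB _ => z /andP[az z1].
  rewrite normrM; apply: le_trans (ler_piMr _ (sin_max _)) _ => //.
  by apply: beta_gamma_density; rewrite z1 (le_trans _ az)// ltW.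
pose i := M^-1.
have iM : i * M = 1 by rewrite mulVf.
have i0 : 0 < i by rewrite invr_gt0; lra.
have naE : n * a * n = 1 by rewrite /a; field; lra.
have na0 : 0 < n * a by rewrite mulr_gt0.
have nai : n * a <= i by nra.
have Nai : N * a <= i by nra.
have ai : a <= i by nra.
have NM : N / M <= 2 by rewrite ler_pdivrMr; lra.
have NM0 : 0 <= N / M by rewrite divr_ge0//; lra.
have Bb : B 1 - B a <= 4 * N * a ^+ 2 + 10 * N / M * a + K.
  have K0 : 0 <= K by rewrite /K divr_ge0//; lra.
  have p1 : 0 <= 4 * N * a ^+ 2 + 10 * N / M * a + K.
    by rewrite !addr_ge0// mulr_ge0 ?exprn_ge0//; nra.
  have p2 : 0 <= expR (- (M * 1)) * (4 * N * 1 ^+ 2 + 10 * N / M * 1 + K).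
    by rewrite mulr_ge0 ?expR_ge0//; nra.
  have eM : expR (- (M * a)) <= 1 by rewrite expR_le1; nra.
  by rewrite /B opprK addrC; have := ler_piMl p1 eM; lra.
have Bi : B 1 - B a <= 45 * i.
  apply: le_trans Bb _.
  have -> : K = i + 10 * (N / M) * i by rewrite /K /i; ring.
  have -> : 4 * N * a ^+ 2 = 4 * (N * a * a) by ring.
  have -> : 10 * N / M * a = 10 * (N / M * a) by ring.
  by nra.
have Da : `|D a| <= 3 * i.
  have h1 : `|primitive (beta_osc m w) a| <= N * a by apply: le_primitive_beta; rewrite a0.
  have h2 := le_primitive_osc w (@continuous_sin R) (@sin_max R) (ltW na0).
  have h3 := le_primitive_osc w (@continuous_cos R) (@cos_max R) (ltW na0).
  rewrite /D; apply: le_trans (ler_normB _ _) _.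
  apply: le_trans (lerD h1 (ler_normB _ _)) _; rewrite !normrM.
  have := ler_pM (normr_ge0 _) (normr_ge0 _) (cos_max (w * ln n)) h2.
  have := ler_pM (normr_ge0 _) (normr_ge0 _) (sin_max (w * ln n)) h3.
  by lra.
have D1 : `|D 1 - (primitive (beta_osc m w) 1 - gamma_osc n w)| <= 2 * i.
  have eni : expR (- n) <= i.
    rewrite expRN lef_pV2 ?posrE ?expR_gt0//; last lra.
    by apply: le_trans (expR_ge1Dx _); lra.
  have h2 := osc_integral_tail w (@continuous_sin R) (@sin_max R) n0.
  have h3 := osc_integral_tail w (@continuous_cos R) (@cos_max R) n0.
  rewrite /D mulr1 /gamma_osc.
  move: (primitive (beta_osc m w) 1) => F.
  move: (primitive (osc sin w) n) (primitive (osc cos w) n) h2 h3 => Ps Pc h2 h3.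
  set C := cos _; set S := sin _.
  have -> : F - (C * Ps - S * Pc) - (F - (C * osc_integral sin w - S * osc_integral cos w))
    = C * (osc_integral sin w - Ps) - S * (osc_integral cos w - Pc) by ring.
  apply: le_trans (ler_normB _ _) _; rewrite !normrM.
  have := ler_pM (normr_ge0 _) (normr_ge0 _) (cos_max (w * ln n)) h2.
  have := ler_pM (normr_ge0 _) (normr_ge0 _) (sin_max (w * ln n)) h3.
  by rewrite -/C -/S; lra.
move: D1 Da (le_trans DB Bi); rewrite -/i.
rewrite !ler_norml => /andP[? ?] /andP[? ?] /andP[? ?].
by apply/andP; split; lra.
Qed.

End Beta.

(** * The sawtooth function *)

Section Sawtooth.
Context {R : realType}.
Implicit Types (x t : R).

Lemma sin_le_id x : 0 <= x -> `|sin x| <= x.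
Proof.
move=> x0; have := @ler_dist_deriveR _ sin (fun y : R => y) cos (fun=> 1) 0 x x0.
by rewrite sin0 !subr0; apply=> y _; exact: cos_max.
Qed.

Lemma sin_ge_quarter x : 0 <= x <= pi / 2 -> x / 4 <= sin x.
Proof.
move=> /andP[x0 xpi].
have half (y : R) : 0 <= y <= 1 -> y / 2 <= sin y.
  move=> /andP[y0 y1].
  have : `|y / 2 - 0 / 2| <= sin y - sin 0.
    apply: (@ler_dist_deriveR _ (fun y => y / 2) sin (fun=> 2^-1) cos) => //.
    - by move=> z _; derive_eq; rewrite !(mulr0, mulr1, add0r).
    - move=> z /andP[z0 zy]; have {z0} [z0 z2] : 0 <= z / 2 /\ z / 2 <= 2^-1 :> R by split; lra.
      rewrite gtr0_norm ?invr_gt0//.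
      have -> : z = (z / 2) *+ 2 by rewrite -[RHS]mulr_natr; field.
      rewrite cos_mulr2n cos2sin2.
      have := sin_le_id z0.
      rewrite -(ler_sqr (normr_nneg _)) ?nnegrE; last lra.
      have q : (z / 2) ^+ 2 <= 4^-1 by nra.
      by rewrite real_normK ?num_real// [(1 - _) *+ 2]mulr2n; lra.
  by rewrite mul0r sin0 !subr0; apply: le_trans; exact: ler_norm.
have [x1|x1] := leP x 1; first by apply: le_trans (half x _); [lra|rewrite x0].
have := half 1; rewrite ler01 lexx => /(_ isT) h1.
have : sin 1 <= sin x.
  apply: ltW; rewrite ltr_sin// in_itv/=; have := @pihalf_02 R; have := @pihalf_ge1 R; lra.
by have := @pihalf_02 R; lra.
Qed.

Lemma sin_natpi (j : nat) : sin (j%:R * pi) = 0 :> R.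
Proof.
by elim: j => [|j IHj]; rewrite ?mul0r ?sin0// -natr1 mulrDl mul1r sinDpi IHj oppr0.
Qed.

Lemma dirichlet_kernel (J : nat) x :
  sin x * (1 + 2 * \sum_(1 <= j < J.+1) cos (2 * j%:R * x)) = sin ((2 * J%:R + 1) * x).
Proof.
elim: J => [|J IHJ]; first by rewrite big_geq// mulr0 addr0 mulr1 add0r mul1r.
rewrite big_nat_recr//= [2 * (_ + _)]mulrDr addrA [sin x * _]mulrDr IHJ.
have -> : (2 * J%:R + 1) * x = 2 * J.+1%:R * x - x by rewrite -[J.+1%:R]natr1; ring.
have -> : (2 * J.+1%:R + 1) * x = 2 * J.+1%:R * x + x by ring.
by rewrite sinB sinD; ring.
Qed.

(** On []0, 1[] the Fourier series of [t - 1/2] is minus the sum, so this is the remainder after [J]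
    terms; it tends to 0 there, but not uniformly. *)
Definition saw (J : nat) t : R :=
  t - 2^-1 + \sum_(1 <= j < J.+1) sin (2 * pi * j%:R * t) / (pi * j%:R).

Lemma saw_onem J t : saw J (1 - t) = - saw J t.
Proof.
rewrite /saw opprD -sumrN; congr (_ + _); first by field.
apply: eq_bigr => j _; rewrite -mulNr; congr (_ / _).
have -> : 2 * pi * j%:R * (1 - t) = (2 * j)%N%:R * pi - 2 * pi * j%:R * t.
  by rewrite natrM; ring.
rewrite sinB sin_natpi mul0r sub0r natrM.
have -> : 2 * j%:R * pi = (j%:R * pi) *+ 2 :> R by rewrite -[RHS]mulr_natr; ring.
by rewrite cos_mulr2n cos2sin2 sin_natpi expr0n/= subr0 [1 *+ 2]mulr2n addrK mul1r.
Qed.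

(** Since [|sin x| <= x] for [x >= 0], each term is at most [2 t]; this serves only for [t] close to
    0. *)
Lemma saw_crude J t : 0 <= t <= 1 -> `|saw J t| <= 1 + 2 * J%:R * t.
Proof.
move=> /andP[t0 t1]; apply: le_trans (ler_normD _ _) _; apply: lerD.
  by rewrite ler_norml; apply/andP; split; lra.
apply: le_trans (ler_norm_sum _ _ _) _.
apply: (@le_trans _ _ (\sum_(1 <= j < J.+1) 2 * t)); last first.
  rewrite sumr_const_nat subSS subn0 -mulr_natr le_eqVlt; apply/orP; left.
  by apply/eqP; ring.
rewrite !big_nat; apply: ler_sum => j /andP[j0 _].
have pj0 : 0 < pi * j%:R :> R by rewrite mulr_gt0 ?pi_gt0// ltr0n.
rewrite normrM (@gtr0_norm _ _^-1) ?invr_gt0// ler_pdivrMr//.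
have -> : 2 * t * (pi * j%:R) = 2 * pi * j%:R * t by ring.
by apply: sin_le_id; rewrite -mulrA -mulrA mulrA mulr_ge0// ?mulr_ge0// ?pi_ge0.
Qed.

(* [e] is the error of the Fourier sum corrected by the first term of its
   asymptotic expansion; [e'] is dominated by the derivative of [B]. *)
Lemma saw_fine J t : 0 < t <= 2^-1 -> `|saw J t| <= 2 / ((2 * J%:R + 1) * t).
Proof.
move=> /andP[t0 t12]; have pi0 := @pi_gt0 R.
pose K : R := 2 * J%:R + 1.
have K0 : 0 < K by rewrite ltr_wpDl// mulr_ge0.
pose S (x : R) := \sum_(1 <= j < J.+1) sin (2 * j%:R * x) / j%:R.
pose e (x : R) := S x - (pi / 2 - x) + cos (K * x) / (K * sin x).
pose B (x : R) := - (K * sin x)^-1.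
pose x := pi * t.
have x0 : 0 < x by rewrite mulr_gt0.
have xpi : x <= pi / 2 by rewrite ler_wpM2l// ltW.
have sin0 (y : R) : x <= y <= pi / 2 -> 0 < sin y.
  by move=> /andP[xy ypi]; apply: lt_le_trans (sin_ge_quarter _); [lra|rewrite ypi; lra].
have dS (y : R) : is_derive y 1 S (2 * \sum_(1 <= j < J.+1) cos (2 * j%:R * y)).
  rewrite mulr_sumr big_add1; apply: (@deriveR_ext _ _ (fun z => \sum_(0 <= j < J) sin (2 * j.+1%:R * z) / j.+1%:R)) => [z|].
    by rewrite /S big_add1.
  notypeclasses refine (deriveR_sum _ _) => j; derive_eq.
  by rewrite !(mulr0, mulr1, addr0, mul0r, add0r); field.
have de (y : R) : x <= y <= pi / 2 ->
    is_derive y 1 e (- cos (K * y) * cos y / (K * sin y ^+ 2)).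
  move=> /sin0 sy; have sy0 : sin y != 0 by rewrite gt_eqF.
  notypeclasses refine (deriveR_eq _ _).
    notypeclasses refine (deriveR_add (deriveR_sub (dS y) _) _); derive.
    by rewrite mulf_neq0// gt_eqF.
  cbv beta.
  have := dirichlet_kernel J y; rewrite -/K.
  move: (\sum_(_ <= _ < _) _) => D DE.
  (* The leading part [sin(K y) / sin y] of [S'] cancels against the derivative of
     [cos(K y) / (K sin y)]; what remains has a factor [1/K]. *)
  have -> : 2 * D = sin (K * y) / sin y - 1 by rewrite -DE; field.
  by field; rewrite sy0 gt_eqF.
have dB (y : R) : x <= y <= pi / 2 -> is_derive y 1 B (cos y / (K * sin y ^+ 2)).
  move=> /sin0 sy; have sy0 : sin y != 0 by rewrite gt_eqF.
  notypeclasses refine (deriveR_eq _ _).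
    by derive; rewrite mulf_neq0// gt_eqF.
  by cbv beta; field; rewrite sy0 gt_eqF.
(* The comparison is anchored at [pi / 2]: every [sin(j pi)] vanishes, and [cos(K pi / 2) = 0]
   because [K] is odd. *)
have epi : e (pi / 2) = 0.
  rewrite /e /S big1 ?sub0r; last first.
    by move=> j _; rewrite (_ : _ * (pi / 2) = j%:R * pi) ?sin_natpi ?mul0r//; field.
  have -> : K * (pi / 2) = J%:R * pi + pi / 2 by rewrite /K; field.
  by rewrite cosDpihalf sin_natpi oppr0 mul0r addr0 subrr oppr0.
have eB : `|e x| <= (K * sin x)^-1.
  rewrite -normrN -[- e x]add0r -epi.
  apply: le_trans (ler_dist_deriveR xpi de dB _) _.
    move=> y xy; have sy := sin0 _ xy; move: xy => /andP[xy ypi].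
    have c0 : 0 <= cos y by apply: cos_ge0_pihalf; rewrite ypi andbT; lra.
    have d0 : 0 <= (K * sin y ^+ 2)^-1 by rewrite invr_ge0 mulr_ge0 ?exprn_ge0// ltW.
    rewrite !normrM normrN (ger0_norm c0) (ger0_norm d0) ler_wpM2r//.
    by rewrite ler_piMl// cos_max.
  rewrite /B opprK addrC gerBl invr_ge0 mulr_ge0//; first exact: ltW.
  by apply/ltW/sin0; rewrite lexx andbT; lra.
have sx : t / 2 <= sin x.
  apply: le_trans (sin_ge_quarter _); last by rewrite (ltW x0).
  by rewrite /x; have := @pi_ge2 R; nra.
have sx0 : 0 < sin x by apply: lt_le_trans sx; lra.
have Kt0 : 0 < K * t by rewrite mulr_gt0.
have Kle : (K * sin x)^-1 <= 2 / (K * t).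
  rewrite -[leRHS]invf_div lef_pV2 ?posrE ?mulr_gt0 ?invr_gt0//.
  by rewrite -mulrA ler_wpM2l// ltW.
have sawE : pi * saw J t = e x - cos (K * x) * (K * sin x)^-1.
  rewrite /saw /e addrK /S mulrDr mulr_sumr addrC; congr (_ + _).
    rewrite !big_nat; apply: eq_bigr => j /andP[j0 _]; rewrite /x.
    have -> : 2 * j%:R * (pi * t) = 2 * pi * j%:R * t by ring.
    move: (sin _) => s; have := lt0r_neq0 pi0; move: (pi : R) => p p0.
    by field; rewrite pnatr_eq0 -lt0n j0 p0.
  by rewrite /x; field.
have : `|pi * saw J t| <= 2 * (2 / (K * t)).
  rewrite sawE (_ : 2 * (2 / _) = 2 / (K * t) + 2 / (K * t)); last by ring.
  apply: le_trans (ler_normB _ _) _; apply: lerD; first exact: le_trans Kle.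
  rewrite normrM (@gtr0_norm _ _^-1) ?invr_gt0 ?mulr_gt0//.
  apply: le_trans Kle; rewrite ler_piMl ?cos_max// invr_ge0 mulr_ge0 ?ltW//.
rewrite normrM (gtr0_norm pi0).
have : 0 <= 2 / (K * t) by rewrite divr_ge0 ?ltW.
have := @pi_ge2 R; have := normr_ge0 (saw J t).
move: (2 / _) (`|_|) => u v; nra.
Qed.

End Sawtooth.

(** * The remainder integral against the sawtooth, and harmonic sums *)

Section EulerMaclaurin.
Context {R : realType}.
Implicit Types (t : R).

Lemma ln2_bounds : 2^-1 <= ln 2 :> R /\ ln 2 <= 1 :> R.
Proof.
split; last by have := @le_ln1Dx R 1; rewrite -[1 + 1]/(2%:R); apply; lra.
have := @le_ln1Dx R (- 2^-1).
have -> : 1 - 2^-1 = 2^-1 :> R by field.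
rewrite lnV ?posrE// => h; rewrite -lerN2; apply: h.
by rewrite ltrN2 invf_lt1// ltr1n.
Qed.

(* The interval is cut at distance [1 / k^2] of its endpoints, where the Fourier
   sum of length [k^3] of the sawtooth starts to be accurate. *)
Lemma saw_derive_bound (W g : R -> R) (M : R) (k : nat) : (1 < k)%N -> 0 <= M ->
  (forall t, 0 <= t <= 1 -> is_derive t 1 W (g t * saw (k ^ 3) t)) ->
  (forall t, 0 <= t <= 1 -> `|g t| <= M) ->
  `|W 1 - W 0| <= 8 * M / k%:R.
Proof.
move=> k1 M0 dW gM; pose K : R := k%:R.
have K2 : 2 <= K by rewrite ler_nat.
pose i := K^-1; have iK : i * K = 1 by rewrite mulVf//; lra.
have i0 : 0 < i by rewrite invr_gt0; lra.
have i2 : i <= 2^-1 by nra.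
(* This cut balances the two bounds: for [J = k^3], the crude bound [1 + 2 k] on a length [k^-2]
   costs about [2/k], and the fine bound is at most [1/k] from [k^-2] on. *)
pose d := i ^+ 2.
have d0 : 0 < d by rewrite exprn_gt0.
have d4 : d <= 4^-1 by rewrite /d; nra.
have JE : (k ^ 3)%:R = K ^+ 3 by rewrite natrX.
have step a b (c : R) : 0 <= a -> a <= b -> b <= 1 ->
    (forall t, a <= t <= b -> `|saw (k ^ 3) t| <= c) ->
    `|W b - W a| <= M * c * (b - a).
  move=> a0 ab b1 sc.
  have -> : M * c * (b - a) = M * c * b - M * c * a by ring.
  apply: (@ler_dist_deriveR _ W (fun t => M * c * t) (fun t => g t * saw (k ^ 3) t) (fun=> M * c)) => // t.
  - by move=> /andP[at_ tb]; apply: dW; rewrite (le_trans a0)// (le_trans tb).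
  - by move=> _; derive_eq; ring.
  - move=> /andP[at_ tb]; rewrite normrM ler_pM ?sc ?at_//.
    by apply: gM; rewrite (le_trans a0)// (le_trans tb).
have crude t : 0 <= t <= d -> `|saw (k ^ 3) t| <= 1 + 2 * K ^+ 3 * d.
  move=> /andP[t0 td]; apply: le_trans (saw_crude _ _) _; first by rewrite t0; lra.
  by rewrite JE lerD2l ler_wpM2l// mulr_ge0// exprn_ge0//; lra.
have fine t : d <= t <= 2^-1 -> `|saw (k ^ 3) t| <= i.
  move=> /andP[dt t12]; apply: le_trans (saw_fine _ _) _.
    by rewrite t12 andbT (lt_le_trans d0).
  have K3 : 0 < K ^+ 3 by rewrite exprn_gt0//; lra.
  rewrite JE ler_pdivrMr; last by rewrite mulr_gt0; nra.
  apply: (@le_trans _ _ (i * ((2 * K ^+ 3 + 1) * d))); last first.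
    by rewrite (ler_wpM2l (ltW i0))// ler_wpM2l//; lra.
  have -> : i * ((2 * K ^+ 3 + 1) * d) = 2 * (i * K) ^+ 3 + i ^+ 3 by rewrite /d; ring.
  by rewrite iK expr1n mulr1 lerDl exprn_ge0// ltW.
have s1 : `|W d - W 0| <= M * (1 + 2 * K ^+ 3 * d) * (d - 0).
  by apply: step => //; lra.
have s2 : `|W 2^-1 - W d| <= M * i * (2^-1 - d).
  by apply: step => //; lra.
have s3 : `|W (1 - d) - W 2^-1| <= M * i * (1 - d - 2^-1).
  apply: step; [lra|lra|lra|] => t /andP[t1 t2].
  have -> : t = 1 - (1 - t) by ring.
  by rewrite saw_onem normrN; apply: fine; apply/andP; split; lra.
have s4 : `|W 1 - W (1 - d)| <= M * (1 + 2 * K ^+ 3 * d) * (1 - (1 - d)).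
  apply: step; [lra|lra|lra|] => t /andP[t1 t2].
  have -> : t = 1 - (1 - t) by ring.
  by rewrite saw_onem normrN; apply: crude; apply/andP; split; lra.
have e1 : M * (1 + 2 * K ^+ 3 * d) * d = M * i ^+ 2 + 2 * M * i.
  have -> : M * (1 + 2 * K ^+ 3 * d) * d = M * i ^+ 2 + 2 * M * i * (i * K) ^+ 3.
    by rewrite /d; ring.
  by rewrite iK expr1n mulr1.
have Mi : M * i ^+ 2 <= M * i * 2^-1 by rewrite -mulrA ler_wpM2l// expr2 ler_wpM2l// ltW.
have Mi0 : 0 <= M * i by rewrite mulr_ge0// ltW.
have Md : 0 <= M * i * d by rewrite mulr_ge0// ltW.
move: s1 s2 s3 s4; rewrite subr0 (_ : 1 - (1 - d) = d); last by ring.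
rewrite e1 -/K -/i; move: (W 0) (W d) (W 2^-1) (W (1 - d)) (W 1) => w0 wd wh w1d w1.
rewrite !mulrBr mulrA !ler_norml => /andP[? ?] /andP[? ?] /andP[? ?] /andP[? ?].
by apply/andP; split; lra.
Qed.

Definition harmonic_sum (n : nat) : R := \sum_(1 <= k < n.+1) k%:R^-1.

(** From [1/(k+1) <= ln(k+1) - ln k <= 1/k], the sequence [u] decreases while [u - 1/n] increases;
    their common limit lies between them. *)
Lemma euler_gamma_bounds n : (0 < n)%N ->
  0 <= harmonic_sum n - ln n%:R - euler_gamma <= (n%:R^-1 : R).
Proof.
pose u (n : nat) : R := harmonic_sum n - ln n%:R.
have step k : (0 < k)%N -> k.+1%:R^-1 - k%:R^-1 <= u k.+1 - u k <= 0.
  move=> k0; have k0' : 0 < k%:R :> R by rewrite ltr0n.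
  have k1' : 0 < k.+1%:R :> R by [].
  rewrite /u /harmonic_sum big_nat_recr//=.
  have l1 : ln k.+1%:R - ln k%:R <= k%:R^-1 :> R.
    rewrite -ln_div ?posrE//; apply: le_trans (le_ln1Dx _); last first.
      by apply: (@lt_le_trans _ _ 0); rewrite ?ltrN10 ?invr_ge0.
    rewrite le_eqVlt; apply/orP; left; apply/eqP; congr ln.
    by rewrite -natr1; field; rewrite gt_eqF.
  have l2 : k.+1%:R^-1 <= ln k.+1%:R - ln k%:R :> R.
    rewrite -lerN2 opprB -ln_div ?posrE//; apply: le_trans (le_ln1Dx _); last first.
      by rewrite ltrN2 invf_lt1// ltr1n ltnS.
    rewrite le_eqVlt; apply/orP; left; apply/eqP; congr ln.
    by rewrite -natr1; field; rewrite natr1 gt_eqF.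
  move: l1 l2; move: (k.+1%:R^-1) (k%:R^-1) (ln k.+1%:R) (ln k%:R) => a b c d l1 l2.
  by set s := \sum_(_ <= _ < _) _; apply/andP; split; lra.
have mono a b : (0 < a)%N -> (a <= b)%N -> u b <= u a /\ u a - a%:R^-1 <= u b - b%:R^-1.
  move=> a0; elim: b => [|b IHb]; first by rewrite leqn0 => /eqP ab; rewrite ab in a0.
  rewrite leq_eqVlt => /predU1P[<-//|]; rewrite ltnS => ab.
  have [h1 h2] := IHb ab; have /andP[] := step b (leq_trans a0 ab).
  move: h1 h2; move: (u b.+1) (u b) (u a) (b.+1%:R^-1) (b%:R^-1) (a%:R^-1).
  by move=> p q r x y z ? ? ? ?; split; lra.
have cu : cvgn u.
  suff : cvgn (fun k => u k.+1) by move=> /cvg_ex[l]; rewrite cvg_shiftS => /cvgP.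
  apply: nonincreasing_is_cvgn; first by move=> a b ab; exact: (mono a.+1 b.+1 _ _).1.
  exists 0 => _ [b _ <-]; have [//|_] := mono 1%N b.+1 isT.
  rewrite {1}/u /harmonic_sum big_nat1 invr1 ln1 subr0 subrr => h.
  by apply: le_trans h _; rewrite gerBl invr_ge0.
move=> n0; have gE : euler_gamma = limn u by [].
rewrite gE; apply/andP; split.
  rewrite subr_ge0; apply: limr_le => //; exists n => //= b nb.
  exact: (mono _ _ n0 nb).1.
rewrite lerBlDl -lerBlDr; apply: limr_ge => //; exists n => //= b nb.
apply: le_trans (mono _ _ n0 nb).2 _.
by rewrite /u gerBl invr_ge0.
Qed.

End EulerMaclaurin.

(** * Expected depth of a leaf *)

Section DepthSum.
Context {R : realType}.
Implicit Types (t : R) (m l L : nat).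

(** [m] stands for [n - 2], and the exponent [m.+1] counts the other keys. *)
Definition depth_sum m L : R := \sum_(0 <= l < L) (1 - (1 - 2 ^- l) ^+ m.+1).

Definition freq (j : nat) : R := 2 * pi * j%:R / ln 2.

(** This is [2^-(l + t)]: as [t] runs over [[0, 1]], level [l] passes continuously to level
    [l.+1]. *)
Definition dyadic l t : R := expR (- (ln 2 * (l%:R + t))).

Lemma ln2_gt0 : 0 < ln 2 :> R.
Proof. by have := (@ln2_bounds R).1; lra. Qed.

Lemma dyadic0 l : dyadic l 0 = 2 ^- l.
Proof.
by rewrite /dyadic addr0 mulrC expRN expRM_natl lnK ?posrE.
Qed.

Lemma dyadic1 l : dyadic l 1 = 2 ^- l.+1.
Proof. by rewrite -dyadic0 /dyadic addr0 natr1. Qed.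

Lemma dyadic_gt0 l t : 0 < dyadic l t. Proof. exact: expR_gt0. Qed.

Lemma dyadic_le l t : 0 <= t -> dyadic l t <= 2 ^- l.
Proof.
move=> t0; rewrite -dyadic0 ler_expR lerN2 ler_wpM2l ?lerD2l//.
exact/ltW/ln2_gt0.
Qed.

Lemma exp2N_le1 l : 2 ^- l <= 1 :> R.
Proof. by rewrite invf_le1 ?exprn_gt0// exprn_ege1// ler1n. Qed.

Lemma deriveR_dyadic l t : is_derive t 1 (dyadic l) (- ln 2 * dyadic l t).
Proof. by rewrite /dyadic; derive_eq; ring. Qed.

(** At frequency [2 pi j / ln 2] in [ln y], one level is a whole number of periods, so all levels
    meet the same Fourier sum. *)
Lemma sin_dyadic j l t : sin (freq j * ln (dyadic l t)) = - sin (2 * pi * j%:R * t).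
Proof.
rewrite /dyadic expRK -sinN.
have -> : freq j * - (ln 2 * (l%:R + t)) = - (2 * pi * j%:R * t) - (j * l)%N%:R * pi *+ 2.
  rewrite /freq natrM -[X in _ = _ - X]mulr_natr.
  have := @ln2_gt0; move: (pi : R) (ln 2 : R) => p q q0.
  by field; rewrite gt_eqF.
rewrite sinB -mulrnAr [(j * l)%:R * _]mulr_natl.
have := periodicn (@sinD2pi R) (j * l) 0; rewrite add0r sin0 => ->.
have := periodicn (@cosD2pi R) (j * l) 0; rewrite add0r cos0 => ->.
by rewrite mulr0 subr0 mulr1.
Qed.

Lemma sum_geometric_onem m (y : R) :
  \sum_(0 <= k < m) (1 - y) ^+ k * y = 1 - (1 - y) ^+ m.
Proof.
elim: m => [|m IHm]; first by rewrite big_geq// expr0 subrr.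
by rewrite big_nat_recr//= IHm exprS; ring.
Qed.

Lemma sum_exp2NE L : \sum_(0 <= l < L) 2 ^- l = 2 - 2 * 2 ^- L :> R.
Proof.
elim: L => [|L IHL]; first by rewrite big_geq// expr0 invr1 mulr1 subrr.
rewrite big_nat_recr//= IHL exprS invfM.
by move: (2 ^- L) => x; field.
Qed.

Lemma sum_exp2N L : \sum_(0 <= l < L) 2 ^- l <= 2 :> R.
Proof. by rewrite sum_exp2NE gerBl mulr_ge0// invr_ge0 exprn_ge0. Qed.

Lemma onem_exp_bounds m (y : R) : 0 <= y <= 1 -> 0 <= 1 - (1 - y) ^+ m <= m%:R * y.
Proof.
move=> /andP[y0 y1]; apply/andP; split.
  by rewrite subr_ge0 exprn_ile1//; lra.
rewrite -sum_geometric_onem; apply: (@le_trans _ _ (\sum_(0 <= k < m) y)).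
  by apply: ler_sum => k _; rewrite ler_piMl// exprn_ile1//; lra.
by rewrite sumr_const_nat subn0 mulr_natl.
Qed.

(* [W] is a primitive of [G' * saw J]: the product [G * (t - 1/2)] contributes the
   Euler-Maclaurin terms, [H] is a primitive of [G], and [P] collects the Fourier
   terms.  All three telescope between [0] and [1]. *)
Lemma depth_sum_fourier m L (k : nat) : (1 < k)%N -> let q : R := 2 ^- L in
  `|depth_sum m L - (1 - q) ^+ m.+1 / 2
    - (\sum_(0 <= i < m.+1) (1 - q) ^+ i.+1 / i.+1%:R) / ln 2
    + \sum_(1 <= j < (k ^ 3).+1)
        (primitive (beta_osc m (freq j)) 1 - primitive (beta_osc m (freq j)) q) / (pi * j%:R)|
  <= 16 * m.+1%:R / k%:R.
Proof.
move=> k1; cbv zeta; set q : R := 2 ^- L; set J := (k ^ 3)%N; set N : R := m.+1%:R.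
pose F j := primitive (beta_osc m (freq j)) : R -> R.
pose G t := \sum_(0 <= l < L) (1 - (1 - dyadic l t) ^+ m.+1).
pose H t := \sum_(0 <= l < L) (\sum_(0 <= i < m.+1) (1 - dyadic l t) ^+ i.+1 / i.+1%:R) / ln 2.
pose P t := \sum_(0 <= l < L) \sum_(1 <= j < J.+1) F j (dyadic l t) / (pi * j%:R).
pose W t := G t * (t - 2^-1) - H t - P t.
pose g t := - \sum_(0 <= l < L) N * (1 - dyadic l t) ^+ m * (ln 2 * dyadic l t).
have lnn0 : ln 2 != 0 :> R by rewrite gt_eqF// ln2_gt0.
have dG t : is_derive t 1 G (g t).
  rewrite /G /g -sumrN; notypeclasses refine (deriveR_sum _ _) => l.
  by derive_eq; rewrite /dyadic /N/=; ring.
(* With [y = dyadic l t], [dy = - ln 2 * y dt] and [(1 - (1 - y)^(m+1)) / y] is a geometric sum; its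
   primitive yields the harmonic number between [y = 1] and [y = 0]. *)
have dH t : is_derive t 1 H (G t).
  rewrite /H /G; notypeclasses refine (deriveR_sum _ _) => l.
  rewrite -sum_geometric_onem.
  notypeclasses refine (deriveR_eq _ _).
    notypeclasses refine (deriveR_mul _ (deriveR_cst _ _)).
    notypeclasses refine (deriveR_sum _ _) => i.
    derive.
  cbv beta; rewrite mulr0 add0r mulr_sumr; apply: eq_bigr => i _ /=.
  by rewrite /dyadic; field; rewrite lnn0 andbT nat1r.
(* The signs of [dyadic'] and of [sin_dyadic] cancel; with [g * (t - 1/2)] this completes
   [g * saw J]. *)
have dP t : 0 <= t <= 1 ->
    is_derive t 1 P (- g t * \sum_(1 <= j < J.+1) sin (2 * pi * j%:R * t) / (pi * j%:R)).
  move=> t01; rewrite /P /g opprK mulr_suml.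
  notypeclasses refine (deriveR_sum _ _) => l.
  rewrite mulr_sumr; notypeclasses refine (deriveR_sum _ _) => j.
  notypeclasses refine (deriveR_eq _ _).
    notypeclasses refine (deriveR_mul _ (deriveR_cst _ _)).
    exact: deriveR_comp (deriveR_dyadic l t) (deriveR_primitive_beta m (freq j) (dyadic_gt0 l t)).
  cbv beta; rewrite /beta_osc sin_dyadic -/N.
  by move: (_^-1); move=> ?; ring.
have dW t : 0 <= t <= 1 -> is_derive t 1 W (g t * saw J t).
  move=> t01; notypeclasses refine (deriveR_eq _ _).
    notypeclasses refine (deriveR_sub (deriveR_sub (deriveR_mul (dG t) _) (dH t)) (dP t t01)).
    by derive.
  by cbv beta; rewrite /saw; ring.
(* The factor [2^-l] makes the bound uniform in [L], so that [L] can tend to infinity while [k] is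
   fixed. *)
have gM t : 0 <= t <= 1 -> `|g t| <= 2 * N.
  move=> /andP[t0 t1]; rewrite normrN; apply: le_trans (ler_norm_sum _ _ _) _.
  apply: (@le_trans _ _ (\sum_(0 <= l < L) N * 2 ^- l)); last first.
    by rewrite -mulr_sumr mulrC ler_wpM2r// sum_exp2N.
  apply: ler_sum => l _.
  have y0 := dyadic_gt0 l t; have yl := dyadic_le l t0; have l1 := exp2N_le1 l.
  have p0 : 0 <= (1 - dyadic l t) ^+ m by rewrite exprn_ge0//; lra.
  have p1 : (1 - dyadic l t) ^+ m <= 1 by rewrite exprn_ile1//; lra.
  have [_ ln1] := @ln2_bounds R; have ln0 := ltW ln2_gt0.
  have N0 : 0 <= N by [].
  rewrite ger0_norm; last by rewrite !mulr_ge0// ltW.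
  rewrite -mulrA ler_wpM2l//; apply: le_trans yl.
  apply: (@le_trans _ _ (ln 2 * dyadic l t)).
    by rewrite ler_piMl// mulr_ge0// ltW.
  by rewrite ler_piMl// ltW.
have M0 : 0 <= 2 * N by rewrite mulr_ge0.
have := saw_derive_bound k1 M0 dW gM.
have -> : 8 * (2 * N) / k%:R = 16 * N / k%:R by ring.
suff -> : W 1 - W 0 = depth_sum m L - (1 - q) ^+ m.+1 / 2
    - (\sum_(0 <= i < m.+1) (1 - q) ^+ i.+1 / i.+1%:R) / ln 2
    + \sum_(1 <= j < J.+1) (F j 1 - F j q) / (pi * j%:R) by [].
have tele (f : nat -> R) : \sum_(0 <= l < L) f l.+1 = \sum_(0 <= l < L) f l + (f L - f 0%N).
  apply/eqP; rewrite addrC -subr_eq -sumrB.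
  by rewrite (telescope_sumr _ (leq0n L)).
have G0 : G 0 = depth_sum m L by apply: eq_bigr => l _; rewrite dyadic0.
have G1 : G 1 = depth_sum m L - (1 - q) ^+ m.+1.
  rewrite /G; under eq_bigr do rewrite dyadic1.
  rewrite (tele (fun l => 1 - (1 - 2 ^- l) ^+ m.+1)).
  by rewrite /depth_sum -/q expr0 invr1 subrr expr0n/= subr0; ring.
have H1 : H 1 - H 0 = (\sum_(0 <= i < m.+1) (1 - q) ^+ i.+1 / i.+1%:R) / ln 2.
  rewrite /H; under eq_bigr do rewrite dyadic1.
  rewrite (tele (fun l => (\sum_(0 <= i < m.+1) (1 - 2 ^- l) ^+ i.+1 / i.+1%:R) / ln 2)).
  under [X in _ + _ - X]eq_bigr do rewrite dyadic0.
  rewrite addrC addKr expr0 invr1 subrr [X in _ - X / _]big1 ?mul0r ?subr0//.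
  by move=> i _; rewrite expr0n/= mul0r.
have P1 : P 1 - P 0 = - \sum_(1 <= j < J.+1) (F j 1 - F j q) / (pi * j%:R).
  pose p l := \sum_(1 <= j < J.+1) F j (2 ^- l) / (pi * j%:R).
  have -> : P 1 = \sum_(0 <= l < L) p l.+1 by apply: eq_bigr => l _; rewrite dyadic1.
  have -> : P 0 = \sum_(0 <= l < L) p l by apply: eq_bigr => l _; rewrite dyadic0.
  rewrite tele /p.
  rewrite addrC addKr expr0 invr1 -sumrB -sumrN; apply: eq_bigr => j _.
  by rewrite -mulrBl -mulNr opprB.
rewrite /W; have -> : forall a b c d e f : R, a - b - c - (d - e - f) = a - d - (b - e) - (c - f).
  by move=> *; ring.
rewrite H1 P1 opprK G0 G1; congr (_ - _ + _).
by field.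
Qed.

End DepthSum.

(** * Asymptotic expansion of the expected depth *)

Section Asymptotics.
Context {R : realType}.

Definition psum (a : nat -> R) (J : nat) : R := \sum_(1 <= j < J.+1) a j.

(* [psum a J - K / J] increases and [psum a J + K / J] decreases. *)
Lemma psum_inv_sqr (a : nat -> R) (K : R) :
  (forall j, (0 < j)%N -> `|a j| <= K / j%:R ^+ 2) ->
  cvgn (psum a) /\ forall J, (0 < J)%N -> `|limn (psum a) - psum a J| <= K / J%:R.
Proof.
move=> aK; have K0 : 0 <= K.
  by have := aK 1%N isT; rewrite expr1n divr1; apply: le_trans.
have step j : (0 < j)%N -> `|a j.+1| <= K / j%:R - K / j.+1%:R.
  move=> j0; apply: le_trans (aK _ _) _ => //.
  have j0' : 0 < j%:R :> R by rewrite ltr0n.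
  have -> : K / j%:R - K / j.+1%:R = K / (j%:R * j.+1%:R).
    by rewrite -[j.+1%:R]natr1; field; rewrite natr1 !gt_eqF.
  rewrite ler_wpM2l// lef_pV2 ?posrE ?mulr_gt0 ?exprn_gt0//.
  by rewrite expr2 ler_wpM2r// ler_nat.
have mono i j : (0 < i)%N -> (i <= j)%N ->
    psum a i - K / i%:R <= psum a j - K / j%:R /\ psum a j + K / j%:R <= psum a i + K / i%:R.
  move=> i0; elim: j => [|j IHj]; first by rewrite leqn0 => /eqP ij; rewrite ij in i0.
  rewrite leq_eqVlt => /predU1P[<-//|]; rewrite ltnS => ij.
  have [h1 h2] := IHj ij; have := step j (leq_trans i0 ij); rewrite ler_norml.
  have -> : psum a j.+1 = psum a j + a j.+1 by rewrite /psum big_nat_recr.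
  move: h1 h2; move: (psum a i) (psum a j) (a j.+1) (K / j.+1%:R) (K / j%:R) (K / i%:R).
  by move=> p q r x y z ? ? /andP[? ?]; split; lra.
have KJ J : 0 <= K / J%:R by rewrite divr_ge0.
have cvgK : (K / n.+1%:R : R) @[n --> \oo] --> 0.
  by rewrite -(mulr0 K); apply: cvgM; [exact: cvg_cst|exact: cvg_harmonic].
have ca : cvgn (psum a).
  suff : cvgn (fun k => psum a k.+1) by move=> /cvg_ex[l]; rewrite cvg_shiftS => /cvgP.
  have cl : cvgn (fun k => psum a k.+1 - K / k.+1%:R).
    apply: nondecreasing_is_cvgn => [i j ij|]; first exact: (mono i.+1 j.+1 _ _).1.
    exists (psum a 1 + K / 1%:R) => _ [b _ <-]; have [//|_] := mono 1%N b.+1 isT.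
    by apply: le_trans; rewrite lerD2l (le_trans _ (KJ _))// oppr_le0.
  move: cl => /cvg_ex[l cl]; apply/cvg_ex; exists (l + 0).
  have -> : (fun k => psum a k.+1) = (fun k => psum a k.+1 - K / k.+1%:R + K / k.+1%:R).
    by apply/funext => k; rewrite subrK.
  exact: cvgD.
split => // J J0; rewrite ler_norml; apply/andP; split.
  rewrite lerBrDr addrC; apply: limr_ge => //; exists J => //= b Jb.
  by apply: le_trans (mono _ _ J0 Jb).1 _; rewrite gerBl.
rewrite lerBlDl; apply: limr_le => //; exists J => //= b Jb.
by apply: le_trans (mono _ _ J0 Jb).2; rewrite lerDl.
Qed.

Lemma freq_gt0 j : (0 < j)%N -> 0 < freq j :> R.
Proof. by move=> j0; rewrite /freq divr_gt0 ?ln2_gt0// !mulr_gt0 ?pi_gt0// ltr0n. Qed.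

Definition fluct_term (n : R) (j : nat) : R := gamma_osc n (freq j) / (pi * j%:R).

Lemma osc_integral_sin_le (w : R) : `|w * osc_integral sin w| <= 9.
Proof.
apply: (@osc_integral_decay _ cos sin (- 1)); rewrite ?normrN1//.
- by move=> x; rewrite mulN1r; exact: is_derive_cos.
- exact: continuous_cos.
- exact: continuous_sin.
- exact: cos_max.
- exact: sin_max.
Qed.

Lemma osc_integral_cos_le (w : R) : `|w * osc_integral cos w| <= 9.
Proof.
apply: (@osc_integral_decay _ sin cos 1); rewrite ?normr1//.
- by move=> x; rewrite mul1r; exact: is_derive_sin.
- exact: continuous_sin.
- exact: continuous_cos.
- exact: sin_max.
- exact: cos_max.
Qed.

(** Both integrals decay like [9 / freq j], which gives [18 ln 2 / (2 pi^2 j^2)]; [pi >= 2] and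
    [ln 2 <= 1] bring this below [3 / j^2]. The free coefficients cover [fluct_term] and both parts
    of [eta2_term]. *)
Lemma rotation_freq_le (c s : R) j : (0 < j)%N -> `|c| <= 1 -> `|s| <= 1 ->
  `|(c * osc_integral sin (freq j) + s * osc_integral cos (freq j)) / (pi * j%:R)|
    <= 3 / j%:R ^+ 2.
Proof.
move=> j0 c1 s1; have w0 := freq_gt0 j0.
have hs := osc_integral_sin_le (freq j); have hc := osc_integral_cos_le (freq j).
have pj : 0 < pi * j%:R :> R by rewrite mulr_gt0 ?pi_gt0 ?ltr0n.
rewrite normrM (@gtr0_norm _ _^-1) ?invr_gt0// ler_pdivrMr//.
have j2 : 0 < j%:R ^+ 2 :> R by rewrite exprn_gt0// ltr0n.
have h : `|c * osc_integral sin (freq j) + s * osc_integral cos (freq j)| * freq j <= 18.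
  rewrite -[X in _ * X](gtr0_norm w0) -normrM mulrDl.
  apply: le_trans (ler_normD _ _) _; rewrite -!mulrA !(mulrC _ (freq j)) !normrM.
  have := ler_pM (normr_ge0 _) (normr_ge0 _) c1 hs.
  have := ler_pM (normr_ge0 _) (normr_ge0 _) s1 hc.
  by rewrite !normrM; lra.
move: h; move: (`|_ + _|) => x h.
have -> : 3 / j%:R ^+ 2 * (pi * j%:R) = 3 * pi / j%:R :> R.
  by move: (pi : R) => p; field; rewrite pnatr_eq0 -lt0n.
have jr : 0 < j%:R :> R by rewrite ltr0n.
rewrite ler_pdivlMr//; move: h; rewrite /freq mulrA ler_pdivrMr ?ln2_gt0//.
have -> : x * (2 * pi * j%:R) = (x * j%:R) * (2 * pi) by ring.
have [_ l1] := @ln2_bounds R; have p2 := @pi_ge2 R; move: (x * _) => y h.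
have : y * (2 * pi) <= 18 by lra.
by move: (pi : R) p2 => p; nra.
Qed.

Lemma fluct_term_le (n : R) j : (0 < j)%N -> `|fluct_term n j| <= 3 / j%:R ^+ 2.
Proof.
move=> j0; rewrite /fluct_term /gamma_osc -mulNr; apply: rotation_freq_le => //.
  exact: cos_max.
by rewrite normrN sin_max.
Qed.

Definition fluct (n : R) : R := limn (psum (fluct_term n)).

Lemma depth_sum_is_cvg m : cvgn (@depth_sum R m).
Proof.
have t0 l : 0 <= 1 - (1 - (2 ^- l : R)) ^+ m.+1 <= m.+1%:R * 2 ^- l.
  by apply: onem_exp_bounds; rewrite exp2N_le1 invr_ge0 exprn_ge0.
apply: nondecreasing_is_cvgn.
  apply/nondecreasing_seqP => L; rewrite /depth_sum big_nat_recr//= lerDl.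
  by have /andP[] := t0 L.
exists (m.+1%:R * 2) => _ [L _ <-].
apply: (@le_trans _ _ (\sum_(0 <= l < L) m.+1%:R * 2 ^- l)).
  by apply: ler_sum => l _; have /andP[] := t0 l.
by rewrite -mulr_sumr ler_wpM2l// sum_exp2N.
Qed.

Definition depth_lim m : R := limn (@depth_sum R m).

Lemma cvg_sumr (I : Type) (r : seq I) (f : I -> nat -> R) (l : I -> R) :
  (forall i, f i L @[L --> \oo] --> l i) ->
  (\sum_(i <- r) f i L) @[L --> \oo] --> \sum_(i <- r) l i.
Proof.
move=> fl; elim: r => [|i r IHr].
  by rewrite big_nil; under eq_fun do rewrite big_nil; exact: cvg_cst.
by rewrite big_cons; under eq_fun do rewrite big_cons; apply: cvgD.
Qed.

Lemma cvg_exp2N : (2 ^- L : R) @[L --> \oo] --> (0 : R).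
Proof.
under eq_fun do rewrite -exprVn; apply: cvg_expr.
by rewrite gtr0_norm ?invr_gt0// invf_lt1// ltr1n.
Qed.

(** [L] tends to infinity with [k] fixed: the error bound does not involve [L], and the terms at
    [q = 2^-L] tend to their values at 0. [k] stays finite, to be chosen in terms of [n]. *)
Lemma depth_lim_fourier m (k : nat) : (1 < k)%N ->
  `|depth_lim m - 2^-1 - harmonic_sum m.+1 / ln 2
    + psum (fun j => primitive (beta_osc m (freq j)) 1 / (pi * j%:R)) (k ^ 3)|
  <= 16 * m.+1%:R / k%:R :> R.
Proof.
move=> k1.
have q0 := cvg_exp2N.
have q1 i : ((1 - 2 ^- L) ^+ i : R) @[L --> \oo] --> (1 : R).
  have c0 : (1 - 2 ^- L : R) @[L --> \oo] --> (1 - 0 : R).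
    by apply: cvgB => //; exact: cvg_cst.
  have := cvg_comp _ _ c0 (@exprn_continuous R i (1 - 0)).
  by rewrite subr0 expr1n.
have Pq j : primitive (beta_osc m (freq j)) (2 ^- L) @[L --> \oo] --> (0 : R).
  apply/norm_cvg0P; apply: (@squeeze_cvgr _ _ _ _ (fun=> 0) (fun L => m.+1%:R * 2 ^- L)).
  - apply: nearW => L; rewrite normr_ge0/= le_primitive_beta//.
    by rewrite exp2N_le1 invr_gt0 exprn_gt0.
  - exact: cvg_cst.
  - by rewrite -(mulr0 m.+1%:R); apply: cvgM => //; exact: cvg_cst.
pose E L : R := depth_sum m L - (1 - 2 ^- L) ^+ m.+1 / 2
    - (\sum_(0 <= i < m.+1) (1 - 2 ^- L) ^+ i.+1 / i.+1%:R) / ln 2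
    + \sum_(1 <= j < (k ^ 3).+1)
        (primitive (beta_osc m (freq j)) 1 - primitive (beta_osc m (freq j)) (2 ^- L)) / (pi * j%:R).
set e : R := (X in `|X|).
suff cE : E L @[L --> \oo] --> e.
  have cnE : `|E L| @[L --> \oo] --> `|e| by exact: cvg_norm.
  apply: (cvgr_to_le cnE); apply: nearW => L.
  exact: depth_sum_fourier.
rewrite /E /e /psum; apply: cvgD; first apply: cvgB; first apply: cvgB.
- exact: depth_sum_is_cvg.
- by rewrite -[X in _ --> X]mul1r; apply: cvgM; [exact: q1|exact: cvg_cst].
- apply: cvgM; last exact: cvg_cst.
  rewrite /harmonic_sum big_add1/=; apply: cvg_sumr => i.
  by rewrite -[X in _ --> X]mul1r; apply: cvgM; [exact: q1|exact: cvg_cst].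
- apply: cvg_sumr => j; apply: cvgM; last exact: cvg_cst.
  by rewrite -[X in _ --> X]subr0; apply: cvgB; [exact: cvg_cst|exact: Pq].
Qed.

Lemma harmonic_sum_le n : (0 < n)%N -> harmonic_sum n <= ln n%:R + 2 :> R.
Proof.
move=> n0; have /andP[_] := @euler_gamma_bounds R _ n0.
have /andP[] := @euler_gamma_bounds R 1 isT.
rewrite {1}/harmonic_sum big_nat1 invr1 ln1 => h _.
have : n%:R^-1 <= 1 :> R by rewrite invf_le1 ?ltr0n// ler1n.
by move: (harmonic_sum n) (ln n%:R) (n%:R^-1) h => a b c; lra.
Qed.

(* The Fourier series is cut at [J = n^6]; the truncation then costs [O(1/n)] and
   the [J] comparisons of coefficients cost [O(ln n / n)]. *)
Lemma depth_lim_asymptotics m : (0 < m)%N -> let n : R := m.+2%:R in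
  `|2 * depth_lim m - 2 - (2 * ln n / ln 2 - 2 * fluct n
     - (ln 2 - 2 * euler_gamma) / ln 2)| <= 5000 / Num.sqrt n.
Proof.
move=> m0; cbv zeta; set n : R := m.+2%:R.
(* [k = n^2] brings the error [16 (n - 1) / k] below [16 / n]. *)
pose k := (m.+2 ^ 2)%N; pose J := (k ^ 3)%N.
have k1 : (1 < k)%N by rewrite /k; case: (m) => // ?; rewrite expnS; lia.
have J0 : (0 < J)%N by rewrite expn_gt0 ltnW.
have n0 : 0 < n by rewrite ltr0n.
have n1 : 1 <= n by rewrite ler1n.
pose i := n^-1; have i0 : 0 < i by rewrite invr_gt0.
have in1 : i * n = 1 by rewrite mulVf// gt_eqF.
have i1 : i <= 1 by rewrite invf_le1.
pose M : R := m%:R; have M1 : 1 <= M by rewrite ler1n.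
have nM : n <= 3 * M by rewrite /n -[m.+2%:R]natr1 -[m.+1%:R]natr1 -/M; lra.
have D1 : `|depth_lim m - 2^-1 - harmonic_sum m.+1 / ln 2
    + psum (fun j => primitive (beta_osc m (freq j)) 1 / (pi * j%:R)) J| <= 16 * i.
  apply: le_trans (depth_lim_fourier m k1) _.
  rewrite /k natrX -/n -mulrA ler_wpM2l//.
  rewrite ler_pdivrMr ?exprn_gt0// expr2 mulrA in1 mul1r.
  by rewrite ler_nat.
(* Each coefficient costs [100 / (m pi j)]; [m >= n / 3] and [pi >= 2] make this at most
   [150 / (n j)], and the sum of [1/j] up to [n^6] is at most [6 ln n + 2]. *)
have D2 : `|psum (fun j => primitive (beta_osc m (freq j)) 1 / (pi * j%:R)) J
    - psum (fluct_term n) J| <= 150 * i * (6 * ln n + 2).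
  rewrite /psum -sumrB; apply: le_trans (ler_norm_sum _ _ _) _.
  apply: (@le_trans _ _ (\sum_(1 <= j < J.+1) 150 * i * j%:R^-1)).
    rewrite !big_nat; apply: ler_sum => j /andP[j0 _].
    rewrite /fluct_term -mulrBl normrM.
    have jr : 0 < j%:R :> R by rewrite ltr0n.
    rewrite (@gtr0_norm _ _^-1) ?invr_gt0 ?mulr_gt0 ?pi_gt0//.
    rewrite invfM mulrA ler_wpM2r ?invr_ge0//.
    rewrite ler_pdivrMr ?pi_gt0//.
    apply: le_trans (beta_gamma _ m0) _; rewrite -/M ler_pdivrMr; last lra.
    have p2 := @pi_ge2 R; have z1 : 300 <= 150 * i * pi * n.
      have -> : 150 * i * pi * n = 150 * pi * (i * n) by ring.
      by rewrite in1; lra.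
    have z0 : 0 <= 150 * i * pi by rewrite !mulr_ge0// ltW// pi_gt0.
    by have := ler_wpM2l z0 nM; lra.
  rewrite -mulr_sumr ler_wpM2l//; first by rewrite mulr_ge0// ltW.
  apply: le_trans (harmonic_sum_le J0) _.
  rewrite /J /k -expnM natrX lnXn// -/n.
  by rewrite -[_ *+ _]mulr_natl.
have D3 : `|fluct n - psum (fluct_term n) J| <= 3 * i.
  have [_ /(_ J J0) h] := psum_inv_sqr (@fluct_term_le n); apply: le_trans h _.
  rewrite ler_wpM2l// lef_pV2 ?posrE ?ltr0n// ler_nat /J /k -expnM.
  by rewrite -{1}(expn1 m.+2) leq_exp2l.
(* The bounds on the constant are taken at [n]; removing the summand [1/n] moves the difference into
   [[-1/n, 0]], and [ln 2 >= 1/2] gives the factor 2. *)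
have D4 : `|harmonic_sum m.+1 / ln 2 - (ln n + euler_gamma) / ln 2| <= 2 * i.
  have := @euler_gamma_bounds R m.+2 isT; rewrite /harmonic_sum big_nat_recr//= -/n -/i.
  rewrite -/(harmonic_sum m.+1) => /andP[h1 h2].
  rewrite -mulrBl normrM (@gtr0_norm _ _^-1) ?invr_gt0 ?ln2_gt0// ler_pdivrMr ?ln2_gt0//.
  apply: (@le_trans _ _ i); first by rewrite ler_norml; apply/andP; split; lra.
  by have [+ _] := @ln2_bounds R; nra.
pose s := Num.sqrt n.
have s1 : 1 <= s by rewrite -(@sqrtr1 R) ler_wsqrtr.
have sn : s ^+ 2 = n by rewrite sqr_sqrtr// ltW.
have lnn : ln n <= 2 * s.
  rewrite -sn lnXn; last lra.
  by rewrite -[_ *+ 2]mulr_natl ler_wpM2l// ltW// ln_sublinear//; lra.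
have is1 : i * s = s^-1 by rewrite /i -sn; field; lra.
have iles : i <= s^-1 by rewrite -is1 ler_peMr// ltW.
(* From [ln n = 2 ln s <= 2 s] and [s >= 1], [6 ln n + 2 <= 14 s]. The total is then
   [2 (16 + 2100 + 3 + 2) = 4242], rounded up to 5000. *)
have D5 : 150 * i * (6 * ln n + 2) <= 2100 * s^-1.
  apply: (@le_trans _ _ (150 * i * (14 * s))).
    by rewrite ler_wpM2l//; [rewrite mulr_ge0// ltW|lra].
  by rewrite -is1 le_eqVlt; apply/orP; left; apply/eqP; ring.
rewrite -/s.
have -> : 2 * ln n / ln 2 - 2 * fluct n - (ln 2 - 2 * euler_gamma) / ln 2
  = 2 * ((ln n + euler_gamma) / ln 2) - 2 * fluct n - 1.
  by move: (ln n) (fluct n) (@euler_gamma R) (@ln2_gt0 R); move: (ln 2) => *; field; lra.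
have s0 : 0 <= s^-1 by rewrite invr_ge0; lra.
move: D1 D2 D3 D4; move: (depth_lim m) (harmonic_sum m.+1 / ln 2) (fluct n) ((ln n + _) / ln 2).
move: (psum _ J) (psum (fluct_term n) J) => p q d h f g.
move: (150 * i * _) D5 => B D5 D1 D2 D3 D4.
have {D1 D2 D3 D4} : `|2 * d - 2 - (2 * g - 2 * f - 1)| <= 2 * (16 * i + B + 3 * i + 2 * i).
  move: D1 D2 D3 D4; rewrite !ler_norml => /andP[? ?] /andP[? ?] /andP[? ?] /andP[? ?].
  by apply/andP; split; lra.
by move=> h1; apply: le_trans h1 _; lra.
Qed.

End Asymptotics.

(** * Expected distance *)

Section Expectation.
Context {d : measure_display} {T : measurableType d} {R : realType}.
Variables (P : probability T R) (n : nat) (key : T -> 'I_n -> nat -> bool).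
Variable pair : T -> 'I_n * 'I_n.
Hypothesis UB : unbiased_bernoulli P key.
Hypothesis UP : uniform_pair P pair.
Hypothesis PI : pair_independent P key pair.

Lemma pair_neq w : (pair w).1 != (pair w).2.
Proof. by case: UP => /(_ w) + _ _; rewrite neq_ltn => ->. Qed.

Section PairEvent.
Variables (B : 'I_n * 'I_n -> set T) (p : R).
Hypothesis sB : forall ij, <<s all_bits key >> (B ij).

Lemma measurable_pair_event : measurable [set w | B (pair w) w].
Proof.
have -> : [set w | B (pair w) w] = \bigcup_(ij in [set: 'I_n * 'I_n]) (B ij `&` pair @^-1` [set ij]).
  by apply/seteqP; split=> [w Bw|w [ij _ [Bw /= pw]]]; [exists (pair w)|rewrite /= pw].
apply: fin_bigcup_measurable; first exact: finite_finset.
move=> ij _; apply: measurableI; last by case: UP.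
exact: all_bits_measurable UB _ (sB ij).
Qed.

(** Conditioning on the pair: by independence each increasing couple contributes [p] times its own
    probability, and the other couples have an empty preimage. *)
Lemma probability_pair_event : (forall ij : 'I_n * 'I_n, (ij.1 < ij.2)%N -> P (B ij) = p%:E) ->
  P [set w | B (pair w) w] = p%:E.
Proof.
move=> PB; case: UP => pair_lt mpair _.
rewrite (total_probability P measurable_pair_event mpair).
rewrite (eq_bigr (fun ij => p%:E * P (setT `&` pair @^-1` [set ij]))%E); last first.
  move=> ij _; rewrite setTI.
  rewrite (_ : _ `&` _ = B ij `&` pair @^-1` [set ij]); last first.
    by apply/seteqP; split=> w /= [Bw pw]; split => //; move: Bw; rewrite pw.
  rewrite PI ?sB//; last by apply: sub_sigma_algebra; exists ij.
  have [ij_lt|ij_ge] := ltnP ij.1 ij.2; first by rewrite PB.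
  rewrite (_ : _ @^-1` _ = set0) ?measure0 ?mule0//.
  by apply/seteqP; split=> w //= E; have := pair_lt w; rewrite E ltnNge ij_ge.
rewrite -ge0_sume_distrr; last by move=> ij _; exact: measure_ge0.
by rewrite -(total_probability P measurableT mpair) probability_setT mule1.
Qed.

End PairEvent.

(** The event that the keys are pairwise distinct, that is, that a trie exists. *)
Definition all_separated : set T := [set w | exists M, keys_separated (key w) M].

Lemma separatedE w M : keys_separated (key w) M = [forall i, ~~ crowded (key w) M i].
Proof.
apply/keys_separatedP/fintype.forallP => [sep i|nc i k ik].
  by apply/fintype.existsP => -[k /andP[/eqP ki ag]]; exact/ki/sep.
apply/eqP; apply: contraT => nik; have /negP := nc k; case.
by apply/fintype.existsP; exists i; rewrite nik.
Qed.

Lemma not_separated_bigcup M : ~` [set w | keys_separated (key w) M] =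
  \bigcup_(i in [set: 'I_n]) [set w | crowded (key w) M i].
Proof.
apply/seteqP; split=> w /=; rewrite separatedE.
  by move=> /negP; rewrite negb_forall => /fintype.existsP[j]; rewrite negbK; exists j.
by move=> [i _ ci] /fintype.forallP/(_ i); rewrite ci.
Qed.

Lemma measurable_crowded M i : measurable [set w | crowded (key w) M i].
Proof. by apply: all_bits_measurable UB _ _; exact: crowded_sigma. Qed.

Lemma measurable_separated M : measurable [set w | keys_separated (key w) M].
Proof.
rewrite -[X in measurable X]setCK not_separated_bigcup; apply: measurableC.
apply: fin_bigcup_measurable; first exact: finite_finset.
by move=> i _; exact: measurable_crowded.
Qed.

Lemma measurable_all_separated : measurable all_separated.
Proof.
have -> : all_separated = \bigcup_M [set w | keys_separated (key w) M].
  by apply/seteqP; split=> [w [M sM]|w [M _ sM]]; exists M.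
by apply: bigcup_measurable => M _; exact: measurable_separated.
Qed.

Lemma probability_not_separated M :
  (P (~` [set w | keys_separated (key w) M]) <= (n%:R * (n%:R * 2 ^- M))%:E)%E.
Proof.
apply: (@le_trans _ _ (\sum_(i : 'I_n) P [set w | crowded (key w) M i])%E).
  rewrite -big_enum/= fsbig_seq ?enum_uniq//.
  apply: content_sub_fsum => [||  |w].
  - exact: finite_seq.
  - by move=> i _; exact: measurable_crowded.
  - by apply: measurableC; exact: measurable_separated.
  - by rewrite not_separated_bigcup => -[i _ ci]; exists i => //=; rewrite mem_enum.
apply: (@le_trans _ _ (\sum_(i : 'I_n) (n%:R * 2 ^- M)%:E)%E).
  apply: lee_sum => i _; rewrite (probability_crowded UB) lee_fin.
  have y01 : 0 <= (2 ^- M : R) <= 1 by rewrite exp2N_le1 invr_ge0 exprn_ge0.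
  have /andP[_ h] := onem_exp_bounds n.-1 y01; apply: le_trans h _.
  by rewrite ler_wpM2r ?ler_nat ?leq_pred//; case/andP: y01.
by rewrite sumEFin sumr_const card_ord -[_ *+ n]mulr_natl.
Qed.

Lemma probability_all_separated : P (~` all_separated) = 0%E.
Proof.
have mD := measurableC measurable_all_separated.
have fD : P (~` all_separated) \is a fin_num by exact: fin_num_measure.
have le M : fine (P (~` all_separated)) <= n%:R * (n%:R * 2 ^- M).
  rewrite -lee_fin fineK//; apply: le_trans (probability_not_separated M).
  apply: le_measure; rewrite ?inE//; first by apply: measurableC; exact: measurable_separated.
  by move=> w nD sM; apply: nD; exists M.
apply/eqP; rewrite eq_le measure_ge0 andbT -(fineK fD) lee_fin.
have c : (n%:R * (n%:R * 2 ^- M) : R) @[M --> \oo] --> (0 : R).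
  rewrite -(mulr0 (n%:R : R)); apply: cvgM; first exact: cvg_cst.
  by rewrite -[X in _ --> X](mulr0 (n%:R : R)); apply: cvgM; [exact: cvg_cst|exact: cvg_exp2N].
by apply: (cvgr_to_ge c); apply: nearW.
Qed.

Lemma probability_setI_separated A : measurable A -> P (A `&` all_separated) = P A.
Proof.
move=> mA; rewrite [RHS](measureDI P mA measurable_all_separated) [X in (X + _)%E](_ : _ = 0%E) ?add0e//.
apply: subset_measure0 probability_all_separated.
- by apply: measurableD => //; exact: measurable_all_separated.
- by apply: measurableC; exact: measurable_all_separated.
- by move=> w [].
Qed.

Definition crowded1 m : set T := [set w | crowded (key w) m (pair w).1].
Definition crowded2 m : set T := [set w | crowded (key w) m (pair w).2].
(** The guard lets agreement, counted from level 1, share the index range of crowding, counted from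
    level 0. *)
Definition agree12 m : set T := [set w | (0 < m)%N && agree (key w) m (pair w).1 (pair w).2].

Lemma measurable_crowded1 m : measurable (crowded1 m).
Proof. by apply: (@measurable_pair_event (fun ij => [set w | crowded (key w) m ij.1])) => ij; exact: crowded_sigma. Qed.

Lemma measurable_crowded2 m : measurable (crowded2 m).
Proof. by apply: (@measurable_pair_event (fun ij => [set w | crowded (key w) m ij.2])) => ij; exact: crowded_sigma. Qed.

Lemma agree120 : agree12 0 = set0.
Proof. by apply/seteqP; split. Qed.

Lemma measurable_agree12 m : measurable (agree12 m).
Proof.
case: m => [|m]; first by rewrite agree120.
by apply: (@measurable_pair_event (fun ij => [set w | agree (key w) m.+1 ij.1 ij.2])) => ij; exact: agree_sigma.
Qed.

Lemma probability_crowded1 m : P (crowded1 m) = (1 - (1 - 2 ^- m) ^+ n.-1)%:E.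
Proof.
apply: (@probability_pair_event (fun ij => [set w | crowded (key w) m ij.1])) => ij.
  exact: crowded_sigma.
by move=> _; exact: probability_crowded.
Qed.

Lemma probability_crowded2 m : P (crowded2 m) = (1 - (1 - 2 ^- m) ^+ n.-1)%:E.
Proof.
apply: (@probability_pair_event (fun ij => [set w | crowded (key w) m ij.2])) => ij.
  exact: crowded_sigma.
by move=> _; exact: probability_crowded.
Qed.

Lemma probability_agree12 m : P (agree12 m) = ((0 < m)%N%:R * 2 ^- m)%:E.
Proof.
case: m => [|m]; first by rewrite agree120 measure0 mul0r.
rewrite mul1r; apply: (@probability_pair_event (fun ij => [set w | agree (key w) m.+1 ij.1 ij.2])) => ij.
  exact: agree_sigma.
by move=> ij_lt; rewrite (probability_agree UB)// neq_ltn ij_lt.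
Qed.

Definition level_term m w : R := \1_(crowded1 m) w + \1_(crowded2 m) w - 2 * \1_(agree12 m) w.

Lemma level_termE m w : level_term m w = (crowded (key w) m (pair w).1)%:R +
  (crowded (key w) m (pair w).2)%:R - 2 * ((0 < m)%N && agree (key w) m (pair w).1 (pair w).2)%:R.
Proof.
have mem (b : T -> bool) : \1_[set w | b w] w = (b w)%:R :> R.
  by rewrite indicE; case: (boolP (b w)) => bw; [rewrite mem_set|rewrite memNset//; exact/negP].
by rewrite /level_term !mem.
Qed.

(** The two chosen keys crowd each other at every level where they agree. Nonnegativity is what
    allows the series and the expectation to be exchanged. *)
Lemma level_term_ge0 m w : 0 <= level_term m w.
Proof.
rewrite level_termE; case: (boolP (agree _ _ _ _)) => [ag|_]; last first.
  by rewrite andbF mulr0 subr0 addr_ge0.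
have -> : crowded (key w) m (pair w).1.
  by apply/fintype.existsP; exists (pair w).2; rewrite eq_sym pair_neq /agree eq_sym.
have -> : crowded (key w) m (pair w).2.
  by apply/fintype.existsP; exists (pair w).1; rewrite pair_neq.
by case: (_ && _); rewrite /=; lra.
Qed.

Lemma measurable_level_term m : measurable_fun setT (level_term m).
Proof.
apply: measurable_funB; first apply: measurable_funD.
- by apply: measurable_indic; exact: measurable_crowded1.
- by apply: measurable_indic; exact: measurable_crowded2.
- by apply: measurable_funM => //; apply: measurable_indic; exact: measurable_agree12.
Qed.

Lemma Delta_series w : all_separated w ->
  (Delta key pair w : R)%:E = (\sum_(m <oo) (level_term m w)%:E)%E.
Proof.
move=> [M0 sM0]; apply/esym/cvg_lim => //; apply: cvg_near_cst; exists M0 => //= M MM0.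
have sM : keys_separated (key w) M.
  by apply/keys_separatedP => i k ag; move/keys_separatedP: sM0; apply; exact: agreeW ag.
rewrite sumEFin; congr EFin; rewrite /Delta.
have := trie_distance_sum (pair_neq w) sM; rewrite -surjective_pairing => /(congr1 (fun k => k%:R : R)).
rewrite natrD natrM !natr_sum => E.
under eq_bigr do rewrite level_termE.
rewrite sumrB -mulr_sumr.
have <- : \sum_(0 <= i < M) (crowded (key w) i (pair w).1 + crowded (key w) i (pair w).2)%:R =
  \sum_(0 <= i < M) ((crowded (key w) i (pair w).1)%:R + (crowded (key w) i (pair w).2)%:R) :> R.
  by apply: eq_bigr => i _; rewrite natrD.
rewrite -E.
case: M {MM0 E} sM => [|M] sM; first by rewrite !big_geq// mulr0 addr0 subr0.
rewrite [X in _ - _ * X]big_nat_recl//= add0r big_add1/=.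
by rewrite addrK.
Qed.

Lemma integral_level_term m : (\int[P]_(w in all_separated) (level_term m w)%:E =
  (2 * (1 - (1 - 2 ^- m) ^+ n.-1) - 2 * ((0 < m)%N%:R * 2 ^- m))%:E)%E.
Proof.
have mD := measurable_all_separated.
have indic A : measurable A -> (\int[P]_(w in all_separated) (\1_A w)%:E = P A)%E.
  by move=> mA; rewrite integral_indic//; exact: probability_setI_separated.
have mi A : measurable A -> measurable_fun all_separated (fun w => (\1_A w)%:E : \bar R).
  by move=> mA; apply/measurable_EFinP; exact: measurable_indic.
have mL : measurable_fun all_separated (fun w => (level_term m w)%:E).
  by apply/measurable_EFinP; apply: measurable_funS (@measurable_level_term m).
have i1 := indic _ (measurable_crowded1 m); have i2 := indic _ (measurable_crowded2 m).
have i3 := indic _ (measurable_agree12 m).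
(* Two copies of the agreement indicator are moved to the left, so that additivity is applied to
   nonnegative functions only; the integral of [level_term] is then solved for. *)
have E : (\int[P]_(w in all_separated) ((level_term m w)%:E + ((\1_(agree12 m) w)%:E + (\1_(agree12 m) w)%:E))
    = \int[P]_(w in all_separated) ((\1_(crowded1 m) w)%:E + (\1_(crowded2 m) w)%:E))%E.
  by apply: eq_integral => w _; rewrite -!EFinD; congr EFin; rewrite /level_term; ring.
move: E; rewrite !ge0_integralD//; rewrite ?i1 ?i2 ?i3.
all: try by (move=> w _; rewrite lee_fin ?indicE ?level_term_ge0).
- rewrite probability_crowded1 probability_crowded2 probability_agree12.
  case: (\int[P]_(w in _) _)%E => [r| |] //=; rewrite -?EFinD => -[E].
  by congr EFin; move: E; move: (_ * 2 ^- m) (1 - _) => a b E; lra.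
- exact/mi/measurable_crowded1.
- exact/mi/measurable_crowded2.
- exact/mi/measurable_agree12.
- exact/mi/measurable_agree12.
- by apply: emeasurable_funD; exact/mi/measurable_agree12.
Qed.

Lemma expectation_Delta : (1 < n)%N -> ('E_P[Delta key pair] = (2 * depth_lim n.-2 - 2)%:E)%E.
Proof.
move=> n1; rewrite unlock.
have Delta0 w : ~ all_separated w -> Delta key pair w = 0 :> R.
  move=> ns; rewrite /Delta trie_distance_not_separated// => M.
  by apply/negP => sM; apply: ns; exists M.
have -> : (\int[P]_w (Delta key pair w : R)%:E =
    \int[P]_(w in all_separated) (Delta key pair w)%:E)%E.
  rewrite [RHS]integral_mkcond; apply: eq_integral => w _.
  rewrite patchE; case: ifPn => //; rewrite notin_setE => /Delta0 ->//.
rewrite (eq_integral (fun w => \sum_(m <oo) (level_term m w)%:E)%E); last first.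
  by move=> w; rewrite inE => Dw; exact: Delta_series.
rewrite integral_nneseries.
- under eq_eseriesr do rewrite integral_level_term.
  apply/cvg_lim => //; under eq_fun do rewrite sumEFin.
  apply: cvg_EFin; first by apply: nearW.
  (* The sum of [2^-m] over [1 <= m < M] is [1 - 2 * 2^-M], hence the constant [- 2] and the
     vanishing term. *)
  apply: (@cvg_trans _ ((2 * depth_sum n.-2 M - 2 + 4 * 2 ^- M : R) @[M --> \oo])).
    apply: near_eq_cvg; exists 1%N => // M M1.
    rewrite /= sumrB -!mulr_sumr.
    have -> : n.-1 = n.-2.+1 by case: (n) n1 => [|[|?]].
    rewrite -/(depth_sum _ _).
    case: M M1 => // M _; rewrite [X in _ = _ - 2 * X]big_nat_recl//= mul0r add0r.
    under [X in _ = _ - 2 * X]eq_bigr do rewrite mul1r.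
    have := @sum_exp2NE R M.+1; rewrite big_nat_recl//= expr0 invr1.
    by move: (\sum_(0 <= i < M) _) (depth_sum _ _) (2 ^- M.+1) => x y z h; lra.
  rewrite -[2 * depth_lim _ - 2]addr0; apply: cvgD.
    apply: cvgB; last exact: cvg_cst.
    by apply: cvgM; [exact: cvg_cst|exact: depth_sum_is_cvg].
  by rewrite -(mulr0 (4 : R)); apply: cvgM; [exact: cvg_cst|exact: cvg_exp2N].
- exact: measurable_all_separated.
- by move=> m; apply/measurable_EFinP; apply: measurable_funS (@measurable_level_term m).
- by move=> m w _; rewrite lee_fin level_term_ge0.
Qed.

End Expectation.

(** * The complex series *)

Local Open Scope complex_scope.

Section ComplexSeries.
Context {R : realType}.

Lemma mulcE (a b c d : R) : (a +i* b) * (c +i* d) = (a * c - b * d) +i* (a * d + b * c).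
Proof. by []. Qed.

Lemma cexp_imag (x : R) : cexp (0 +i* x) = cos x +i* sin x.
Proof. by rewrite /cexp/= expR0 mulcE !mul1r !mul0r subr0 addr0. Qed.

(** At real part 0 the continuation takes exactly one step, Gamma(i w) = Gamma(1 + i w) / (i w);
    dividing by i exchanges the cosine and sine integrals. *)
Lemma Gamma_imag (w : R) : w != 0 ->
  Gamma (0 +i* w) = (osc_integral sin w / w) +i* (- (osc_integral cos w / w)).
Proof.
move=> w0; rewrite /Gamma/= ltxx oppr0 truncn0 big_nat1 addr0.
have -> : Gamma_integral (0 +i* w + 1) = osc_integral cos w +i* osc_integral sin w :> R[i].
  have lnE t : (0 +i* w) * (ln t)%:C = 0 +i* (w * ln t).
    by rewrite mulcE !(mul0r, mulr0) subr0 add0r.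
  rewrite /Gamma_integral addrK /osc_integral; congr (_ +i* _);
    by apply: eq_Rintegral => t _; rewrite lnE cexp_imag mulcE/= !mulr0 ?subr0 ?add0r.
apply: (@mulIf _ (0 +i* w)); first by rewrite eq_complex/= (negPf w0) andbF.
rewrite mulfVK; last by rewrite eq_complex/= (negPf w0) andbF.
rewrite mulcE; congr (_ +i* _); field; by [].
Qed.

Lemma freq_complex (j : int) :
  2 * pi%:C * 'i * j%:~R / (ln 2)%:C = 0 +i* (2 * pi * j%:~R / ln 2) :> R[i].
Proof.
rewrite -complexiE -[in LHS](rmorph_int (real_complex R)) -[2](rmorph_nat (real_complex R) 2).
rewrite -fmorphV -[(pi : R)%:C]/(pi +i* 0) /=.
rewrite -![(_ : R)%:C]/(_ +i* 0) !mulcE.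
congr (_ +i* _); ring.
Qed.

(** Real part of [eta2_term u j] for [j > 0], up to the factor [ln 2 / 2] that is taken out of
    [1 / freq j]; [eta2_im] is the imaginary part. *)
Definition eta2_re (u : R) j : R := (cos (2 * pi * j%:R * u) * osc_integral sin (freq j)
    - sin (2 * pi * j%:R * u) * osc_integral cos (freq j)) / (pi * j%:R).
Definition eta2_im (u : R) j : R := - (sin (2 * pi * j%:R * u) * osc_integral sin (freq j)
    + cos (2 * pi * j%:R * u) * osc_integral cos (freq j)) / (pi * j%:R).

Lemma osc_integral_cosN (w : R) : osc_integral cos (- w) = osc_integral cos w.
Proof. by apply: eq_Rintegral => t _; rewrite /osc mulNr cosN. Qed.

Lemma osc_integral_sinN (w : R) : osc_integral sin (- w) = - osc_integral sin w.
Proof.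
rewrite -[RHS]mulN1r /osc_integral -RintegralZl//.
  by apply: eq_Rintegral => t _; rewrite /osc mulNr sinN mulN1r mulNr.
apply: integrable_le_expRN => [y y0|y _]; last by apply: osc_le; exact: sin_max.
by apply: osc_continuous => //; exact: continuous_sin.
Qed.

Lemma angle_complex (u : R) (j : int) :
  - (2 * pi%:C * 'i * j%:~R * u%:C) = 0 +i* (- (2 * pi * j%:~R * u)) :> R[i].
Proof.
rewrite -complexiE -[in LHS](rmorph_int (real_complex R)) -[2](rmorph_nat (real_complex R) 2).
rewrite -![(_ : R)%:C]/(_ +i* 0) !mulcE -[LHS]/(_ +i* _).
by congr (_ +i* _); ring.
Qed.

Lemma eta2_term_pos u j : (0 < j)%N ->
  eta2_term u j%:Z = (ln 2 / 2 * eta2_re u j) +i* (ln 2 / 2 * eta2_im u j).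
Proof.
move=> j0; rewrite /eta2_term freq_complex angle_complex /intmul -/(freq j).
have w0 := @freq_gt0 R _ j0.
rewrite Gamma_imag ?gt_eqF// cexp_imag mulcE sinN cosN /eta2_re /eta2_im.
move: (osc_integral _ _) (osc_integral _ _) (sin _) (cos _) => p q S C.
have jn : j%:R != 0 :> R by rewrite pnatr_eq0 -lt0n.
rewrite /freq; have := lt0r_neq0 (@pi_gt0 R); have := lt0r_neq0 (@ln2_gt0 R).
move: (pi : R) (ln 2 : R) => P l l0 P0.
by congr (_ +i* _); field; rewrite jn l0 P0.
Qed.

(** The cosine integral is even in [w] and the sine integral odd, so terms of opposite indices are
    conjugate. *)
Lemma eta2_term_neg u j : (0 < j)%N ->
  eta2_term u (- j%:Z) = (ln 2 / 2 * eta2_re u j) +i* (- (ln 2 / 2 * eta2_im u j)).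
Proof.
move=> j0; rewrite /eta2_term freq_complex angle_complex mulrNz /intmul.
have -> : 2 * pi * - j%:R / ln 2 = - freq j :> R by rewrite /freq; ring.
have w0 := @freq_gt0 R _ j0.
rewrite Gamma_imag ?oppr_eq0 ?gt_eqF// osc_integral_cosN osc_integral_sinN.
have -> : - (2 * pi * - j%:R * u) = 2 * pi * j%:R * u :> R by ring.
rewrite cexp_imag mulcE /eta2_re /eta2_im.
move: (osc_integral _ _) (osc_integral _ _) (sin _) (cos _) => p q S C.
have jn : j%:R != 0 :> R by rewrite pnatr_eq0 -lt0n.
rewrite /freq; have := lt0r_neq0 (@pi_gt0 R); have := lt0r_neq0 (@ln2_gt0 R).
move: (pi : R) (ln 2 : R) => P l l0 P0.
by congr (_ +i* _); field; rewrite jn l0 P0.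
Qed.

Lemma cvg_complex (a b : nat -> R) (l m : R) :
  a n @[n --> \oo] --> l -> b n @[n --> \oo] --> m ->
  (a n +i* b n : R[i]^o) @[n --> \oo] --> (l +i* m : R[i]^o).
Proof.
move=> al bm; apply/cvgrPdist_le => /= e; rewrite ltcE/= => /andP[/eqP e0 e1].
have e2 : 0 < complex.Re e / 2 by rewrite divr_gt0.
move/cvgrPdist_le : al => /(_ _ e2) al; move/cvgrPdist_le : bm => /(_ _ e2) bm.
near=> n.
have -> : e = (complex.Re e)%:C by case: (e) e0 => x y /= ->.
have -> : l +i* m - a n +i* b n = (l - a n)%:C + 'i%C * (m - b n)%:C.
  by rewrite [LHS]complexE.
apply: le_trans (ler_normD _ _) _.
rewrite normrM !normc_def/= !expr0n/= !addr0 add0r expr1n sqrtr1 mul1r !sqrtr_sqr.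
rewrite -rmorphD lecR (splitr (complex.Re e)) lerD//; by near: n.
Unshelve. all: by end_near. Qed.

Lemma sum_complex (a b : nat -> R) (r : seq nat) :
  \sum_(j <- r) (a j +i* b j) = (\sum_(j <- r) a j) +i* (\sum_(j <- r) b j).
Proof.
elim: r => [|j r IHr]; first by rewrite !big_nil.
by rewrite !big_cons IHr.
Qed.

Lemma psum_scale (c : R) (a : nat -> R) : cvgn (psum a) ->
  psum (fun j => c * a j) @ \oo --> c * limn (psum a).
Proof.
move=> ca; rewrite (_ : psum _ = fun J => c * psum a J).
  by apply: cvgM => //; exact: cvg_cst.
by apply/funext => J; rewrite /psum mulr_sumr.
Qed.

Lemma psum_opp (a : nat -> R) l : psum a @ \oo --> l -> psum (fun j => - a j) @ \oo --> - l.
Proof.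
move=> ca; rewrite (_ : psum _ = fun J => - psum a J); first exact: cvgN.
by apply/funext => J; rewrite /psum sumrN.
Qed.

Lemma eta2_re_cvg u : cvgn (psum (eta2_re u)).
Proof.
apply: (psum_inv_sqr (K := 3) _).1 => j j0; rewrite /eta2_re -mulNr.
by apply: rotation_freq_le; rewrite ?cos_max ?normrN ?sin_max.
Qed.

Lemma eta2_im_cvg u : cvgn (psum (eta2_im u)).
Proof.
apply: (psum_inv_sqr (K := 3) _).1 => j j0; rewrite /eta2_im opprD -!mulNr.
by apply: rotation_freq_le => //; rewrite normrN ?cos_max ?sin_max.
Qed.

Definition eta2_half u : R[i] :=
  (ln 2 / 2 * limn (psum (eta2_re u))) +i* (ln 2 / 2 * limn (psum (eta2_im u))).

Lemma eta2_pos_cvg u :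
  (\sum_(1 <= j < N.+1) eta2_term u j%:Z : R[i]^o) @[N --> \oo] --> (eta2_half u : R[i]^o).
Proof.
rewrite (_ : (fun N => _) = (fun N => psum (fun j => ln 2 / 2 * eta2_re u j) N +i*
    psum (fun j => ln 2 / 2 * eta2_im u j) N)); last first.
  apply/funext => N; rewrite /psum -sum_complex !big_nat; apply: eq_bigr => j /andP[j0 _].
  exact: eta2_term_pos.
apply: cvg_complex; apply: psum_scale; [exact: eta2_re_cvg|exact: eta2_im_cvg].
Qed.

Lemma eta2_neg_cvg u :
  (\sum_(1 <= j < N.+1) eta2_term u (- j%:Z) : R[i]^o) @[N --> \oo]
    --> ((eta2_half u)^* : R[i]^o).
Proof.
rewrite (_ : (fun N => _) = (fun N => psum (fun j => ln 2 / 2 * eta2_re u j) N +i*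
    psum (fun j => - (ln 2 / 2 * eta2_im u j)) N)); last first.
  apply/funext => N; rewrite /psum -sum_complex !big_nat; apply: eq_bigr => j /andP[j0 _].
  exact: eta2_term_neg.
apply: cvg_complex; first by apply: psum_scale; exact: eta2_re_cvg.
by apply: psum_opp; apply: psum_scale; exact: eta2_im_cvg.
Qed.

Lemma eta2_series_cvg (u : R) : punctured_series_cvg (eta2_term u).
Proof.
by split; apply/cvg_ex; [exists (eta2_half u); exact: eta2_pos_cvg
  |exists (eta2_half u)^*; exact: eta2_neg_cvg].
Qed.

(** The one-sided sums are conjugate and add up to twice a real part, which
    [freq j * ln n = 2 pi j lg n] identifies with [fluct n]. *)
Lemma eta_lg (n : R) : eta (lg n) = (- 2 * fluct n)%:C.
Proof.
rewrite /eta /eta2 /punctured_series.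
rewrite (cvg_lim (@norm_hausdorff _ _) (@eta2_pos_cvg _)).
rewrite (cvg_lim (@norm_hausdorff _ _) (@eta2_neg_cvg _)).
have -> : fluct n = limn (psum (eta2_re (lg n))).
  congr (limn (psum _)); apply/funext => j; rewrite /fluct_term /gamma_osc /eta2_re.
  have -> // : freq j * ln n = 2 * pi * j%:R * lg n.
  by rewrite /freq /lg; ring.
rewrite addcJ /eta2_half/= -fmorphV.
rewrite -[2](rmorph_nat (real_complex R) 2) -rmorphN -!rmorphM; congr (_%:C).
have := lt0r_neq0 (@ln2_gt0 R); move: (ln 2 : R) (limn _) => l x l0.
by field.
Qed.

End ComplexSeries.

Lemma powR_le_sqrt (R : realType) (n : R) : 1 <= n -> n `^ (4999 / 10 ^+ 4) <= Num.sqrt n.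
Proof.
move=> n1; rewrite -powR12_sqrt; last lra.
by apply: ler_powR => //; rewrite ler_pdivrMr; lra.
Qed.

Theorem proposition1 (R : realType) :
  (forall u : R, punctured_series_cvg (eta2_term u)) /\
  exists C : R, \forall n \near \oo, (2 <= n)%N ->
    forall (d : measure_display) (T : measurableType d) (P : probability T R)
           (key : T -> 'I_n -> nat -> bool) (pair : T -> 'I_n * 'I_n),
      unbiased_bernoulli P key ->
      uniform_pair P pair ->
      pair_independent P key pair ->
      ('E_P[Delta key pair])%E \is a fin_num /\
      `| (fine ('E_P[Delta key pair])%E)%:C
         - ((2 * lg n%:R)%:C + eta (lg n%:R)
            - ((ln 2 - 2 * euler_gamma) / ln 2)%:C) |
        <= (C / n%:R `^ (4999 / 10 ^+ 4))%:C.
Proof.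
split; first exact: eta2_series_cvg.
(* From [n = 3] on, [m = n - 2] is positive, as required where the Beta integral is compared within
   [100 / m]. *)
exists 5000; exists 3%N => // n n3 n2 d T P key pair UB UP PI.
rewrite (expectation_Delta UB UP PI)//; split => //=.
have -> : n = n.-2.+2 :> nat by case: (n) n2 => [|[|?]].
rewrite [n.-2.+2.-2]/=; set m := n.-2.
have m0 : (0 < m)%N by rewrite /m; case: (n) n3 => [|[|[|?]]].
(* By [eta_lg] every term is real, so the complex modulus is an absolute value. *)
rewrite eta_lg -rmorphD -!rmorphB normc_def/= expr0n/= addr0 sqrtr_sqr lecR.
rewrite (_ : _ - _ = 2 * depth_lim m - 2 - (2 * ln m.+2%:R / ln 2 - 2 * fluct m.+2%:R
  - (ln 2 - 2 * euler_gamma) / ln 2)); last by rewrite /lg; ring.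
apply: le_trans (depth_lim_asymptotics m0) _.
have n1 : 1 <= m.+2%:R :> R by rewrite ler1n.
apply: ler_wpM2l; first exact: ler0n.
by rewrite lef_pV2 ?posrE ?powR_gt0 ?sqrtr_gt0 ?ltr0n//; exact: powR_le_sqrt.
Qed.
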